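(* Let $d,m,N$ be positive integers, $0<\Lambda_1<\dots<\Lambda_N$, $A_1,\dots,A_N\in\mathbb{R}^{d\times d}$, $B\in\mathbb{R}^{d\times m}$, $g\in L^\infty([0,\Lambda_N],\mathbb{R}^{d\times d})$, $q\in[1,+\infty)$. The input-output system $$\begin{cases} x(t)=\sum_{j=1}^N A_j x(t-\Lambda_j)+\int_0^{\Lambda_N} g(s)x(t-s)\,ds+Bu(t), & t\ge \inf\operatorname{supp}(u),\\ x(t)=0, & t<\inf\operatorname{supp}(u),\\ y(t)=x(t-\Lambda_N), & t\ge 0,\end{cases}$$ with inputs $u\in\Omega_q:=\{u\in L^q(\mathbb{R},\mathbb{R}^m): \operatorname{supp}(u)\subseteq\mathbb{R}_- \text{ is compact}\}$, is pseudo-rational of order zero.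
   Context: $\mathcal{E}'(\mathbb{R}_-)$ denotes the distributions on $\mathbb{R}$ with compact support contained in $\mathbb{R}_-=(-\infty,0]$, and $\mathcal{D}'_+(\mathbb{R})$ the distributions with support bounded on the left, which is an algebra under convolution $*$; $\delta_x$ is the Dirac mass at $x$. For $\phi\in L^q_{\rm loc}(\mathbb{R},\mathbb{R}^d)$, $\pi(\phi)$ denotes its restriction to $[0,+\infty)$. The system is called pseudo-rational of order zero if there exist a $d\times d$ matrix $Q$ and a $d\times m$ matrix $P$, both with entries in $\mathcal{E}'(\mathbb{R}_-)$, such that (1) $Q$ has a convolution inverse $Q^{-1}$, a $d\times d$ matrix with entries in $\mathcal{D}'_+(\mathbb{R})$ with $Q^{-1}*Q=Q*Q^{-1}=\delta_0 I_d$, and the distribution $\det(Q^{-1})$ has order zero; (2) for every input $u\in\Omega_q$ the output satisfies $y=\pi(Q^{-1}*P*u)$. *)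

(* Defs.v *)
From HB Require Import structures.
From mathcomp Require Import all_boot all_order all_algebra.
From mathcomp Require Import all_classical all_reals all_analysis.
From mathcomp Require Import fingroup perm.
From Stdlib Require Import ClassicalEpsilon.
Set Implicit Arguments. Unset Strict Implicit. Unset Printing Implicit Defensive.
Import Order.TTheory GRing.Theory Num.Theory.
Import numFieldNormedType.Exports.
Local Open Scope classical_set_scope.
Local Open Scope ring_scope.

Section Distributions.
Variable R : realType.
Local Notation mu := (@lebesgue_measure R).

Definition smooth (f : R -> R) : Prop :=
  forall (n : nat) (x : R), derivable (derive1n n f) x 1.

Definition test_fun (f : R -> R) : Prop :=
  smooth f /\ exists K : R, forall x, K < `|x| -> f x = 0.

(* a distribution is a linear functional; only its values on test
   functions matter *)
Definition pdistr := (R -> R) -> R.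

Definition supported_in (K : R) (f : R -> R) : Prop :=
  forall x, K < `|x| -> f x = 0.

Definition is_distr (T : pdistr) : Prop :=
  (forall (a : R) (f g : R -> R), test_fun f -> test_fun g ->
      T (fun x => a * f x + g x) = a * T f + T g) /\
  (forall K : R, exists (k : nat) (C : R), forall (phi : R -> R) (M : nat -> R),
      test_fun phi -> supported_in K phi ->
      (forall j x, (j <= k)%N -> `|derive1n j phi x| <= M j) ->
      `|T phi| <= C * \sum_(0 <= j < k.+1) M j).

Definition order_zero (T : pdistr) : Prop :=
  forall K : R, exists C : R, forall (phi : R -> R) (M : R),
      test_fun phi -> supported_in K phi ->
      (forall x, `|phi x| <= M) -> `|T phi| <= C * M.

Definition deq (S T : pdistr) : Prop := forall phi, test_fun phi -> S phi = T phi.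

Definition supp_ge (a : R) (T : pdistr) : Prop :=
  forall phi, test_fun phi -> (exists e : R, 0 < e /\ forall x, a - e <= x -> phi x = 0) ->
    T phi = 0.

Definition supp_in (a b : R) (T : pdistr) : Prop :=
  forall phi, test_fun phi ->
    (exists e : R, 0 < e /\ forall x, a - e <= x <= b + e -> phi x = 0) ->
    T phi = 0.

Definition in_Dplus (T : pdistr) : Prop := is_distr T /\ exists a, supp_ge a T.

Definition in_Eminus (T : pdistr) : Prop :=
  is_distr T /\ exists a, a <= 0 /\ supp_in a 0 T.

Definition dzero : pdistr := fun _ => 0.
Definition dadd (S T : pdistr) : pdistr := fun phi => S phi + T phi.
Definition dscale (c : R) (T : pdistr) : pdistr := fun phi => c * T phi.
Definition delta0 : pdistr := fun phi => phi 0.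

(* U = S * T for S, T in D'_+ :
   <S*T, phi> = < S_x , chi(x) < T_y , phi(x+y) > >  for a cut-off chi equal to
   1 near [a, K-b] (supp S in [a,oo), supp T in [b,oo), supp phi in [-K,K]) *)
Definition conv_rel (S T U : pdistr) : Prop :=
  forall (a b K : R) (phi chi : R -> R),
    supp_ge a S -> supp_ge b T -> test_fun phi -> supported_in K phi ->
    test_fun chi -> (forall x, a - 1 <= x <= K - b + 1 -> chi x = 1) ->
    U phi = S (fun x => chi x * T (fun y => phi (x + y))).

(* convolution (well defined on D'_+, where a U with conv_rel always exists) *)
Definition conv (S T : pdistr) : pdistr :=
  epsilon (inhabits dzero) (fun U => conv_rel S T U).

Definition fdistr (f : R -> R) : pdistr :=
  fun phi => Rintegral mu setT (fun x => f x * phi x).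

Definition dmx (n p : nat) := 'I_n -> 'I_p -> pdistr.

Definition dmx_conv (n p r : nat) (M : dmx n p) (N : dmx p r) : dmx n r :=
  fun i j => \big[dadd/dzero]_(k < p) conv (M i k) (N k j).

Definition dmx_deltaI (n : nat) : dmx n n :=
  fun i j => if i == j then delta0 else dzero.

Definition dmx_eq (n p : nat) (M N : dmx n p) : Prop :=
  forall i j, deq (M i j) (N i j).

Definition dmx_det (n : nat) (M : dmx n n) : pdistr :=
  \big[dadd/dzero]_(s : {perm 'I_n})
     dscale ((-1) ^+ s) (\big[conv/delta0]_(i < n) M i (s i)).

Definition nz_near (n : nat) (u : R -> 'cV[R]_n) (t e : R) : set R :=
  [set s | t - e < s < t + e /\ u s != 0].

Definition ess_supp (n : nat) (u : R -> 'cV[R]_n) : set R :=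
  [set t | forall e : R, 0 < e -> (0 < mu (nz_near u t e))%E].

Definition Lq_fun (q : R) (f : R -> R) : Prop :=
  measurable_fun setT f /\
  (\int[mu]_(x in setT) ((`|f x| `^ q)%:E) < +oo)%E.

Definition Lq_loc (q : R) (f : R -> R) : Prop :=
  measurable_fun setT f /\
  forall a b : R, (\int[mu]_(x in `[a, b]) ((`|f x| `^ q)%:E) < +oo)%E.

Definition Omega (q : R) (m : nat) (u : R -> 'cV[R]_m) : Prop :=
  (forall i, Lq_fun q (fun t => u t i 0)) /\
  exists a : R, a <= 0 /\ ess_supp u `<=` `[a, 0].

(* An input-output system is given by the relation  io u y  ("y is the
   output of the system for the input u"). *)
Definition pseudo_rational0 (d m : nat) (q : R)
    (io : (R -> 'cV[R]_m) -> (R -> 'cV[R]_d) -> Prop) : Prop :=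
  exists (Q : dmx d d) (P : dmx d m) (Qinv : dmx d d),
    (forall i j, in_Eminus (Q i j)) /\ (forall i j, in_Eminus (P i j)) /\
    (forall i j, in_Dplus (Qinv i j)) /\
    dmx_eq (dmx_conv Qinv Q) (@dmx_deltaI d) /\
    dmx_eq (dmx_conv Q Qinv) (@dmx_deltaI d) /\
    order_zero (dmx_det Qinv) /\
    forall u y, Omega q u -> io u y ->
      exists z : R -> 'cV[R]_d,
        (forall i, Lq_loc q (fun t => z t i 0)) /\
        dmx_eq (dmx_conv Qinv (dmx_conv P (fun k (_ : 'I_1) => fdistr (fun t => u t k 0))))
               (fun i (_ : 'I_1) => fdistr (fun t => z t i 0)) /\
        {ae mu, forall t, 0 <= t -> y t = z t}.

(* t >= inf supp(u), with the convention inf emptyset = +oo (supp u is closed) *)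
Definition after_supp (m : nat) (u : R -> 'cV[R]_m) (t : R) : Prop :=
  exists s, ess_supp u s /\ s <= t.

Definition DI_io (d m N : nat) (q : R) (Lam : nat -> R) (A : nat -> 'M[R]_(d, d))
    (B : 'M[R]_(d, m)) (g : R -> 'M[R]_(d, d))
    (u : R -> 'cV[R]_m) (y : R -> 'cV[R]_d) : Prop :=
  exists x : R -> 'cV[R]_d,
    (forall i, Lq_loc q (fun t => x t i 0)) /\
    {ae mu, forall t, after_supp u t ->
       x t = \sum_(1 <= j < N.+1) A j *m x (t - Lam j)
             + \col_i (\sum_k Rintegral mu `[0, Lam N] (fun s => g s i k * x (t - s) k 0))
             + B *m u t} /\
    {ae mu, forall t, ~ after_supp u t -> x t = 0} /\
    (forall t, 0 <= t -> y t = x (t - Lam N)).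

End Distributions.

(* Main.v *)
(** With [K = \sum_j A_j delta_{Lam_j} + g 1_[0, Lam_N]], the state equation
    reads [(delta_0 I - K) * x = B u].  Take [P = B delta_0] and
    [Q = delta_{-Lam_N} * (delta_0 I - K)], and invert [Q] by [delta_{Lam_N}]
    times the Neumann series of [K].  As [K] has no mass at the origin, its total
    variation weighted by [e^{- lam t}] is arbitrarily small for large [lam], so
    the series converges to a matrix of locally finite measures, and
    [det Q^{-1}] has order zero.

    All measures are treated as functionals on smooth functions whose support is
    only bounded on the right, where [(S * T) f = S_x (T_y f(x + y))] needs no
    cut-off.  Associativity is then definitional, and commutativity, hence
    Fubini, is avoided except for the single identity
    [g * x = (t |-> \int g(s) x(t - s) ds)]. *)

From Stdlib Require Import ClassicalEpsilon.
From HB Require Import structures.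
From mathcomp Require Import all_boot all_order all_algebra.
From mathcomp Require Import all_classical all_reals all_analysis.
From mathcomp Require Import measurable_realfun ring lra.
Require Import Defs.
Set Implicit Arguments. Unset Strict Implicit. Unset Printing Implicit Defensive.
Import Order.TTheory GRing.Theory Num.Theory.
Import numFieldNormedType.Exports.
Local Open Scope classical_set_scope.
Local Open Scope ring_scope.

(** * Smooth functions and cut-offs *)

Section smooth_functions.
Variable R : realType.
Implicit Types (f g : R -> R) (x c d l h : R).

Lemma is_derive_quadratic_remainder f x l C e : 0 < e ->
  (forall h, `|h| < e -> `|f (x + h) - f x - h * l| <= C * h ^+ 2) ->
  is_derive x 1 f l.
Proof.
move=> e0 fC.
have cvl : h^-1 *: ((f \o shift x) (h *: 1) - f x) @[h --> 0^'] --> l.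
  apply/cvgrPdist_le => eps eps0; near=> h.
  have h0 : h != 0 by near: h; exact: nbhs_dnbhs_neq.
  have he : `|h| < e by near: h; apply: dnbhs0_lt.
  have hC : `|h| <= eps / (`|C| + 1).
    by near: h; apply: dnbhs0_le; rewrite divr_gt0// ltr_pwDr.
  rewrite /= /GRing.scale /= mulr1 distrC.
  have -> : h^-1 * (f (h + x) - f x) - l = h^-1 * (f (x + h) - f x - h * l).
    by rewrite (addrC h x) [RHS]mulrBr mulKf.
  rewrite normrM normfV ler_pdivrMl ?normr_gt0//.
  apply: (le_trans (fC _ he)); rewrite -[h ^+ 2]real_normK ?num_real// expr2.
  apply: (@le_trans _ _ (`|C| * (`|h| * `|h|))).
    by rewrite ler_wpM2r ?mulr_ge0// ler_norm.
  rewrite mulrCA ler_wpM2l//.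
  rewrite ler_pdivlMr ?ltr_pwDr// in hC; apply: le_trans hC.
  by rewrite mulrC ler_wpM2l// lerDl.
by apply: DeriveDef; [apply/cvg_ex; exists l|exact: cvg_lim cvl].
Unshelve. all: by end_near. Qed.

Lemma is_derive_derive1 f f' : (forall x, is_derive x 1 f (f' x)) ->
  derive1 f = f'.
Proof.
by move=> ff'; apply/funext => x; rewrite derive1E; apply: derive_val.
Qed.

Lemma is_derive_mul f g x (a b : R) : is_derive x 1 f a -> is_derive x 1 g b ->
  is_derive x 1 (fun y => f y * g y) (a * g x + f x * b).
Proof.
move=> fa gb; have := is_deriveM fa gb; move/is_derive_eq; apply.
by rewrite /GRing.scale/= addrC (mulrC a).
Qed.

Lemma is_derive_mull c f x l : is_derive x 1 f l ->
  is_derive x 1 (fun y => c * f y) (c * l).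
Proof. exact: is_deriveZ. Qed.

Lemma is_derive_exp f n x l : is_derive x 1 f l ->
  is_derive x 1 (fun y => f y ^+ n) (n%:R * f x ^+ n.-1 * l).
Proof.
move=> fl; have -> : (fun y => f y ^+ n) = f ^+ n.
  by apply/funext => y; rewrite fctE.
exact: is_deriveX.
Qed.

Lemma is_derive_affine f c d x l : is_derive (c * x + d) 1 f l ->
  is_derive x 1 (fun y => f (c * y + d)) (c * l).
Proof.
move=> fl.
have dg : is_derive x 1 (fun y => c * y + d) c.
  have := is_deriveD (is_derive_mull c (is_derive_id x 1))
    (is_derive_cst d x 1).
  by move/is_derive_eq; apply; rewrite mulr1 addr0.
have := @is_derive1_comp R f (fun y => c * y + d) x l c fl dg.
by move/is_derive_eq; apply; rewrite mulrC.
Qed.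

Lemma smooth_derive_stable (S : set (R -> R)) :
  (forall f, S f -> exists2 f', S f' & forall x, is_derive x 1 f (f' x)) ->
  S `<=` @smooth R.
Proof.
move=> dS f Sf n x.
have /dS[f' _ df'] : S (derive1n n f).
  elim: n => [|n /dS[f' Sf' df']]; first by rewrite derive1n0.
  by rewrite derive1nS (is_derive_derive1 df').
by have := df' x => ?; apply: ex_derive.
Qed.

Inductive fun_span (G : set (R -> R)) : set (R -> R) :=
| fun_span_gen f : G f -> fun_span G f
| fun_span_lin c f g :
    fun_span G f -> fun_span G g -> fun_span G (fun x => c * f x + g x).

Lemma smooth_fun_span (G : set (R -> R)) :
  (forall f, G f ->
    exists2 f', fun_span G f' & forall x, is_derive x 1 f (f' x)) ->
  fun_span G `<=` @smooth R.
Proof.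
move=> dG; apply: smooth_derive_stable => f.
elim=> {f} [f /dG//|c f g _ [f' sf' df'] _ [g' sg' dg']].
exists (fun x => c * f' x + g' x); first exact: fun_span_lin.
by move=> x; exact: is_deriveD (is_derive_mull c (df' x)) (dg' x).
Qed.

Lemma smooth_derivable f x : smooth f -> derivable f x 1.
Proof. by move=> /(_ 0%N x); rewrite derive1n0. Qed.

Lemma smooth_derive1 f : smooth f -> smooth (derive1 f).
Proof. by move=> sf n x; have := sf n.+1 x; rewrite /derive1n iterSr. Qed.

Lemma smooth_is_derive f x : smooth f -> is_derive x 1 f (derive1 f x).
Proof.
by move=> sf; rewrite derive1E; apply: DeriveDef => //; exact: smooth_derivable.
Qed.

Lemma smooth_continuous f : smooth f -> continuous f.
Proof.
by move=> sf x;
  apply/differentiable_continuous/derivable1_diffP/smooth_derivable.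
Qed.

Lemma smooth_measurable f : smooth f -> measurable_fun [set: R] f.
Proof.
by move=> sf; apply: continuous_measurable_fun; exact: smooth_continuous.
Qed.

Lemma smooth_cst c : smooth (fun _ : R => c).
Proof.
apply: (smooth_derive_stable (S := [set fun=> b | b in setT]));
  last by exists c.
by move=> _ [b _ <-]; exists (fun=> 0);
  [exists 0|move=> x; exact: is_derive_cst].
Qed.

Lemma smooth_lin c f g : smooth f -> smooth g ->
  smooth (fun x => c * f x + g x).
Proof.
move=> sf sg; apply: (smooth_fun_span (G := @smooth R)); last first.
  by apply: fun_span_lin; exact: fun_span_gen.
move=> h sh; exists (derive1 h); first exact/fun_span_gen/smooth_derive1.
by move=> x; exact: smooth_is_derive.
Qed.

Lemma smoothD f g : smooth f -> smooth g -> smooth (fun x => f x + g x).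
Proof.
move=> sf sg; have := @smooth_lin 1 _ _ sf sg; congr smooth.
by apply/funext => x; rewrite mul1r.
Qed.

Lemma smoothM f g : smooth f -> smooth g -> smooth (fun x => f x * g x).
Proof.
pose G :=
  [set h | exists f g, [/\ smooth f, smooth g & h = fun x => f x * g x]].
move=> sf sg; apply: (smooth_fun_span (G := G)); last first.
  by apply: fun_span_gen; exists f, g.
move=> _ [f1 [g1 [sf1 sg1 ->]]].
exists (fun x => 1 * (derive1 f1 x * g1 x) + f1 x * derive1 g1 x).
  apply: (fun_span_lin 1 (f := fun x => derive1 f1 x * g1 x));
    apply: fun_span_gen.
  - by exists (derive1 f1), g1; split; [exact: smooth_derive1|exact: sg1|].
  - by exists f1, (derive1 g1); split; [exact: sf1|exact: smooth_derive1|].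
by move=> x; rewrite mul1r; apply: is_derive_mul; exact: smooth_is_derive.
Qed.

Lemma smooth_affine f c d : smooth f -> smooth (fun x => f (c * x + d)).
Proof.
pose S := [set h | exists2 f, smooth f & h = fun x => f (c * x + d)].
move=> sf; apply: (smooth_derive_stable (S := S)); last by exists f.
move=> _ [g sg ->]; exists (fun x => c * derive1 g (c * x + d)).
  exists (fun x => c * derive1 g x); last by [].
  by apply: smoothM; [exact: smooth_cst|exact: smooth_derive1].
by move=> x; apply: is_derive_affine; exact: smooth_is_derive.
Qed.

Lemma smooth_shift f c : smooth f -> smooth (fun x => f (c + x)).
Proof.
move=> /(@smooth_affine _ 1 c); congr smooth; apply/funext => x.
by rewrite mul1r addrC.
Qed.

Lemma smoothV g : smooth g -> (forall x, g x != 0) ->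
  smooth (fun x => (g x)^-1).
Proof.
move=> sg g0.
pose G := [set h | exists f n, smooth f /\ h = fun x => f x * (g x)^-1 ^+ n].
apply: (smooth_fun_span (G := G)); last first.
  apply: fun_span_gen; exists (fun=> 1), 1%N; split; first exact: smooth_cst.
  by apply/funext => x; rewrite mul1r.
move=> _ [f [n [sf ->]]].
exists (fun x => - n%:R * (f x * derive1 g x * (g x)^-1 ^+ n.+1)
                 + derive1 f x * (g x)^-1 ^+ n).
  apply: (fun_span_lin _ (f := fun x => f x * derive1 g x * (g x)^-1 ^+ n.+1));
    apply: fun_span_gen.
  - exists (fun x => f x * derive1 g x), n.+1; split; last by [].
    exact: smoothM sf (smooth_derive1 sg).
  - by exists (derive1 f), n; split; first exact: smooth_derive1.
move=> x; have dX := is_derive_exp n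
  (is_deriveV (g0 x) (smooth_is_derive x sg)).
have := is_derive_mul (smooth_is_derive x sf) dX.
move/is_derive_eq; apply; rewrite /GRing.scale/= addrC; congr (_ + _).
case: n {dX} => [|n] /=; first by rewrite oppr0 !(mul0r, mulr0).
by rewrite -exprVn !exprS; set y := (g x)^-1; set k := n.+1%:R; ring.
Qed.

Lemma smooth_MVT f x y : smooth f -> exists c, [/\ Num.min x y <= c,
  c <= Num.max x y & f y - f x = derive1 f c * (y - x)].
Proof.
move=> sf.
wlog xy : x y / x <= y.
  move=> wl; have /orP[/wl//|/wl[c [mc cM fc]]] := le_total x y.
  exists c; rewrite minC maxC; split=> //.
  by rewrite -[LHS]opprB fc -mulrN opprB.
have [||c] := @MVT_segment _ f (derive1 f) x y xy.
- by move=> z _; exact: smooth_is_derive.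
- by apply: continuous_subspaceT => z; exact: smooth_continuous.
- rewrite in_itv/= => /andP[xc cy] fc; exists c; split=> //.
    by rewrite ge_min xc.
  by rewrite le_max cy orbT.
Qed.

Lemma smooth_Taylor1 f x h M : smooth f ->
  (forall y, x - `|h| <= y -> `|derive1 (derive1 f) y| <= M) ->
  `|f (x + h) - f x - h * derive1 f x| <= M * h ^+ 2.
Proof.
move=> sf fM.
have [c [mc cM]] := smooth_MVT x (x + h) sf.
have [e [me _]] := smooth_MVT x c (smooth_derive1 sf).
rewrite (addrC x h) addrK => fe fc.
rewrite fc mulrC -mulrBr fe normrM -[h ^+ 2]real_normK ?num_real//.
have h1 : - `|h| <= h by rewrite lerNl -normrN ler_norm.
have h2 := ler_norm h.
have cx : `|c - x| <= `|h|.
  rewrite ler_norml; move: mc cM; rewrite ge_min le_max => /orP mc /orP cM.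
  have h0 := normr_ge0 h.
  by apply/andP; split; case: mc; case: cM => *; lra.
have Me : `|derive1 (derive1 f) e| <= M.
  apply: fM; apply: le_trans me; rewrite le_min; move: cx; rewrite ler_norml.
  by move=> /andP[cx _]; have h0 := normr_ge0 h; apply/andP; split; lra.
by rewrite [in leLHS]normrM expr2 [leRHS]mulrCA ler_wpM2l// ler_pM.
Qed.

End smooth_functions.

Section cutoff.
Variable R : realType.
Implicit Types (x : R) (n : nat).

(* The powers make the linear span of these functions stable under
   differentiation. *)
Definition flat n x : R := if 0 < x then x^-1 ^+ n * expR (- x^-1) else 0.

Lemma flat_ge0 n x : 0 <= flat n x.
Proof.
rewrite /flat; case: ifPn => // x0.
by rewrite mulr_ge0 ?expR_ge0// exprn_ge0// invr_ge0 ltW.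
Qed.

Lemma flat_le_sqr n x : `|flat n x| <= n.+2`!%:R * x ^+ 2.
Proof.
rewrite /flat; case: ifPn => x0; last by rewrite normr0 mulr_ge0 ?sqr_ge0.
have y0 : 0 < x^-1 by rewrite invr_gt0.
rewrite ger0_norm; last by rewrite mulr_ge0 ?expR_ge0// exprn_ge0// ltW.
rewrite expRN ler_pdivrMr ?expR_gt0//.
have := expR_ge1Dxn n.+1 (ltW y0); set y := x^-1 => ey.
have F0 : 0 < n.+2`!%:R :> R by rewrite ltr0n fact_gt0.
have {}ey : y ^+ n.+2 <= n.+2`!%:R * expR y.
  by rewrite mulrC -ler_pdivrMr//; apply: le_trans ey; rewrite lerDr.
have -> : y ^+ n = y ^+ n.+2 * x ^+ 2.
  rewrite -(addn2 n) exprD -mulrA -exprMn /y mulVf ?gt_eqF//.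
  by rewrite expr1n mulr1.
by rewrite [leRHS]mulrAC ler_wpM2r ?sqr_ge0.
Qed.

Lemma is_derive_flat_gt0 n x : 0 < x ->
  is_derive x 1 (flat n) (- n%:R * flat n.+1 x + flat n.+2 x).
Proof.
move=> x0.
suff : is_derive x 1 (fun y : R => y^-1 ^+ n * expR (- y^-1))
    (- n%:R * flat n.+1 x + flat n.+2 x).
  apply: near_eq_is_derive; near=> y; rewrite /flat ifT//.
  by near: y; exact: lt_nbhsr.
have dV := is_deriveV (lt0r_neq0 x0) (is_derive_id x 1).
have dE := @is_derive1_comp _ expR (fun y : R => - y^-1) x _ _
  (is_derive_expR (- x^-1)) (is_deriveN dV).
have := is_derive_mul (is_derive_exp n dV) dE.
move/is_derive_eq; apply; rewrite /flat x0 /GRing.scale/= !mulr1 opprK.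
case: n => [|n]; rewrite /= ?expr0 ?oppr0 ?mul0r ?mul1r ?add0r.
  by rewrite exprVn mulrC.
by rewrite !exprS !exprVn; field; rewrite ?expf_neq0 ?gt_eqF.
Unshelve. all: by end_near. Qed.

Lemma is_derive_flat n x :
  is_derive x 1 (flat n) (- n%:R * flat n.+1 x + flat n.+2 x).
Proof.
have [x0|x0|->] := ltgtP x 0; last 2 first.
- exact: is_derive_flat_gt0.
- rewrite {2 3}/flat ltxx mulr0 addr0.
  apply: (@is_derive_quadratic_remainder _ _ _ _ n.+2`!%:R 1) => // h _.
  by rewrite {2}/flat ltxx add0r mulr0 !subr0; exact: flat_le_sqr.
have -> : - n%:R * flat n.+1 x + flat n.+2 x = 0.
  by rewrite /flat ltNge ltW//= mulr0 addr0.
apply: (near_eq_is_derive (f := cst 0)) => //.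
near=> y; rewrite /flat /cst/= ltNge ltW//=.
by near: y; exact: lt_nbhsl.
Unshelve. all: by end_near. Qed.

Lemma smooth_flat n : smooth (flat n).
Proof.
apply: (smooth_fun_span (G := range flat)); last first.
  by apply: fun_span_gen; exists n.
move=> _ [m _ <-]; exists (fun x => - m%:R * flat m.+1 x + flat m.+2 x).
  by apply: fun_span_lin; apply: fun_span_gen; [exists m.+1|exists m.+2].
exact: is_derive_flat.
Qed.

Definition smooth_step x := flat 0 x / (flat 0 x + flat 0 (1 - x)).

Lemma smooth_step_den_gt0 x : 0 < flat 0 x + flat 0 (1 - x).
Proof.
have [x0|x0] := ltP 0 x.
  by rewrite ltr_pwDl ?flat_ge0// /flat x0 mul1r expR_gt0.
rewrite ltr_pwDr ?flat_ge0// /flat ifT ?mul1r ?expR_gt0//.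
by rewrite subr_gt0 (le_lt_trans x0).
Qed.

Lemma smooth_smooth_step : smooth smooth_step.
Proof.
have s0 := @smooth_flat 0.
have s1 : smooth (fun x => flat 0 (1 - x)).
  move: (@smooth_affine _ _ (-1) 1 s0); congr smooth.
  by apply/funext => x; rewrite mulN1r addrC.
apply: (smoothM s0); apply: (smoothV (smoothD s0 s1)) => x.
by rewrite gt_eqF// smooth_step_den_gt0.
Qed.

Lemma smooth_step_eq0 x : x <= 0 -> smooth_step x = 0.
Proof. by move=> x0; rewrite /smooth_step {1}/flat ltNge x0 mul0r. Qed.

Lemma smooth_step_eq1 x : 1 <= x -> smooth_step x = 1.
Proof.
move=> x1; have := smooth_step_den_gt0 x; rewrite /smooth_step.
have -> : flat 0 (1 - x) = 0 by rewrite /flat ltNge subr_le0 x1.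
by rewrite addr0 => f0; rewrite divff// gt_eqF.
Qed.

Lemma test_fun_cutoff (a b : R) :
  exists2 chi : R -> R, test_fun chi & forall x, a <= x <= b -> chi x = 1.
Proof.
pose up x := smooth_step (1 * x + (1 - a)).
pose down x := smooth_step (-1 * x + (b + 1)).
exists (fun x => up x * down x).
  split.
    by apply: smoothM; apply: smooth_affine; exact: smooth_smooth_step.
  exists (`|a| + `|b| + 1) => x; have := ler_norm b; have := ler_norm (- a).
  rewrite normrN; have := normr_ge0 a; have := normr_ge0 b.
  have [x0|x0] := ger0P x => b0 a0 ab bb K.
    by rewrite /down smooth_step_eq0 ?mulr0//; lra.
  by rewrite /up smooth_step_eq0 ?mul0r//; lra.
by move=> x /andP[ax xb]; rewrite /up /down !smooth_step_eq1 ?mulr1//; lra.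
Qed.

End cutoff.

(** * Measures as functionals, and their convolution *)

Section right_bounded_test_functions.
Variable R : realType.
Implicit Types (f g : R -> R) (x b c K L : R).

Definition vanish_gt K f := forall x, K < x -> f x = 0.

Definition rtest_fun f := smooth f /\ exists K, vanish_gt K f.

Lemma vanish_gtW K L f : K <= L -> vanish_gt K f -> vanish_gt L f.
Proof. by move=> KL fK y Ly; apply: fK; exact: le_lt_trans Ly. Qed.

Lemma vanish_gt_shift K x f :
  vanish_gt K f -> vanish_gt (K - x) (fun y => f (x + y)).
Proof. by move=> fK y; rewrite ltrBlDl => /fK. Qed.

Lemma supported_vanish_gt K f : supported_in K f -> vanish_gt K f.
Proof. by move=> fK x Kx; apply: fK; rewrite (lt_le_trans Kx)// ler_norm. Qed.

Lemma test_fun_rtest f : test_fun f -> rtest_fun f.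
Proof.
by move=> [sf [K fK]]; split=> //; exists K; exact: supported_vanish_gt.
Qed.

Lemma rtest_fun0 : rtest_fun (fun=> 0).
Proof. by split; [exact: smooth_cst|exists 0]. Qed.

Lemma rtest_fun_lin c f g :
  rtest_fun f -> rtest_fun g -> rtest_fun (fun x => c * f x + g x).
Proof.
move=> [sf [K fK]] [sg [L gL]]; split; first exact: smooth_lin.
exists (Num.max K L) => x; rewrite gt_max => /andP[/fK -> /gL ->].
by rewrite mulr0 addr0.
Qed.

Lemma rtest_funZ c f : rtest_fun f -> rtest_fun (fun x => c * f x).
Proof.
move=> rf; have := @rtest_fun_lin c _ _ rf rtest_fun0; congr rtest_fun.
by apply/funext => x; rewrite addr0.
Qed.

Lemma rtest_funB f g : rtest_fun f -> rtest_fun g ->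
  rtest_fun (fun x => f x - g x).
Proof.
move=> rf rg; have := @rtest_fun_lin (-1) _ _ rg rf; congr rtest_fun.
by apply/funext => x; rewrite mulN1r addrC.
Qed.

Lemma rtest_fun_sum (I : Type) (r : seq I) (F : I -> R -> R) :
  (forall i, rtest_fun (F i)) -> rtest_fun (fun x => \sum_(i <- r) F i x).
Proof.
move=> rF; elim: r => [|i r IHr].
  by have := rtest_fun0; congr rtest_fun; apply/funext => x; rewrite big_nil.
have := @rtest_fun_lin 1 _ _ (rF i) IHr; congr rtest_fun.
by apply/funext => x; rewrite big_cons mul1r.
Qed.

Lemma rtest_fun_shift x f : rtest_fun f -> rtest_fun (fun y => f (x + y)).
Proof.
move=> [sf [K fK]]; split; first exact: smooth_shift.
by exists (K - x); exact: vanish_gt_shift.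
Qed.

Lemma vanish_gt_derive1 K f : vanish_gt K f -> vanish_gt K (derive1 f).
Proof.
move=> fK x Kx; rewrite derive1E.
rewrite (@near_eq_derive _ _ _ f (cst 0)) ?derive_cst//.
by near=> y; apply: fK; near: y; exact: lt_nbhsr.
Unshelve. all: by end_near. Qed.

Lemma rtest_fun_derive1 f : rtest_fun f -> rtest_fun (derive1 f).
Proof.
move=> [sf [K fK]]; split; first exact: smooth_derive1.
by exists K; exact: vanish_gt_derive1.
Qed.

Lemma rtest_fun_bounded f b :
  rtest_fun f -> exists M, forall x, b <= x -> `|f x| <= M.
Proof.
move=> [sf [K fK]].
have [bK|Kb] := leP b K; last first.
  by exists 0 => x bx; rewrite fK ?normr0// (lt_le_trans Kb).
have cf : {within `[b, K], continuous (fun x => `|f x|)}.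
  apply: continuous_subspaceT => x.
  by apply: continuous_comp; [exact: smooth_continuous|exact: norm_continuous].
have [c _ fc] := EVT_max bK cf.
exists `|f c| => x bx; have [xK|Kx] := leP x K; last by rewrite fK ?normr0.
by apply: fc; rewrite in_itv/= bx xK.
Qed.

End right_bounded_test_functions.

Section radon_measures.
Variable R : realType.
Local Notation pdistr := (pdistr R).
Implicit Types (D E : set R) (f g : R -> R) (c K M x : R) (S T : pdistr).

(* Integration against a locally finite signed measure carried by [D], which is
   meant to be bounded on the left: [M = 0] gives the support condition. *)
Definition is_radon D T : Prop :=
  (forall c f g, rtest_fun f -> rtest_fun g ->
    T (fun x => c * f x + g x) = c * T f + T g) /\
  (forall K, exists C : R, forall f M, rtest_fun f -> vanish_gt K f ->
    (forall x, D x -> `|f x| <= M) -> `|T f| <= C * M).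

Definition point_mass c : pdistr := fun f => f c.

Definition dshift c T : pdistr := fun f => T (fun x => f (c + x)).

Lemma radon0 D T : is_radon D T -> T (fun=> 0) = 0.
Proof.
move=> [lT _]; have := lT (-1) _ _ (@rtest_fun0 R) (@rtest_fun0 R).
have -> : (fun x : R => -1 * 0 + 0) = fun=> 0 :> R.
  by apply/funext => x; rewrite mulr0 addr0.
by rewrite mulN1r addNr.
Qed.

Lemma radonZ D T c f : is_radon D T -> rtest_fun f ->
  T (fun x => c * f x) = c * T f.
Proof.
move=> mT rf; have := mT.1 c _ _ rf (@rtest_fun0 R).
by rewrite (radon0 mT) addr0 => <-; congr T; apply/funext => x; rewrite addr0.
Qed.

Lemma radonD D T f g : is_radon D T -> rtest_fun f -> rtest_fun g ->
  T (fun x => f x + g x) = T f + T g.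
Proof.
move=> mT rf rg; have := mT.1 1 _ _ rf rg.
by rewrite mul1r => <-; congr T; apply/funext => x; rewrite mul1r.
Qed.

Lemma radonB D T f g : is_radon D T -> rtest_fun f -> rtest_fun g ->
  T (fun x => f x - g x) = T f - T g.
Proof.
move=> mT rf rg; have := mT.1 (-1) _ _ rg rf.
rewrite mulN1r addrC => <-; congr T.
by apply/funext => x; rewrite mulN1r addrC.
Qed.

Lemma radon_sum D T (I : Type) (r : seq I) (F : I -> R -> R) : is_radon D T ->
  (forall i, rtest_fun (F i)) ->
  T (fun x => \sum_(i <- r) F i x) = \sum_(i <- r) T (F i).
Proof.
move=> mT rF; elim: r => [|i r IHr].
  rewrite big_nil -[RHS](radon0 mT); congr T.
  by apply/funext => x; rewrite big_nil.
rewrite big_cons -IHr -(radonD mT)//; last exact: rtest_fun_sum.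
by congr T; apply/funext => x; rewrite big_cons.
Qed.

Lemma radon_eq0 D T f : is_radon D T -> rtest_fun f ->
  (forall x, D x -> f x = 0) -> T f = 0.
Proof.
move=> [_ bT] rf f0; have [_ [K fK]] := rf; have [C CT] := bT K.
apply/eqP; rewrite -normr_le0 -(mulr0 C).
by apply: CT => // x /f0 ->; rewrite normr0.
Qed.

Lemma radon_eq D T f g : is_radon D T -> rtest_fun f -> rtest_fun g ->
  (forall x, D x -> f x = g x) -> T f = T g.
Proof.
move=> mT rf rg fg; apply/eqP; rewrite -subr_eq0 -(radonB mT rf rg); apply/eqP.
by apply: (radon_eq0 mT) => [|x /fg ->]; [exact: rtest_funB|rewrite subrr].
Qed.

Lemma is_radonS D E T : D `<=` E -> is_radon D T -> is_radon E T.
Proof.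
move=> DE [lT bT]; split=> // K; have [C CT] := bT K.
by exists C => f M rf fK fM; apply: CT => // x /DE; exact: fM.
Qed.

Lemma is_radon0 D : is_radon D (@dzero R).
Proof.
split=> [c f g _ _|K]; first by rewrite /dzero mulr0 addr0.
by exists 0 => f M _ _ _; rewrite normr0 mul0r.
Qed.

Lemma is_radonD D S T : is_radon D S -> is_radon D T -> is_radon D (dadd S T).
Proof.
move=> [lS bS] [lT bT]; split=> [c f g rf rg|K].
  by rewrite /dadd lS// lT//; ring.
have [A AS] := bS K; have [B BT] := bT K; exists (A + B) => f M rf fK fM.
by rewrite mulrDl (le_trans (ler_normD _ _))// lerD ?AS ?BT.
Qed.

Lemma is_radonZ D c T : is_radon D T -> is_radon D (dscale c T).
Proof.
move=> [lT bT]; split=> [e f g rf rg|K].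
  by rewrite /dscale lT//; ring.
have [C CT] := bT K; exists (`|c| * C) => f M rf fK fM.
by rewrite /dscale normrM -mulrA ler_wpM2l// CT.
Qed.

Lemma is_radon_sum D (I : Type) (r : seq I) (P : pred I) (T : I -> pdistr) :
  (forall i, P i -> is_radon D (T i)) ->
  is_radon D (\big[@dadd R/@dzero R]_(i <- r | P i) T i).
Proof. by apply: big_ind; [exact: is_radon0|exact: is_radonD]. Qed.

Lemma is_radon_point_mass D c : D c -> is_radon D (point_mass c).
Proof.
by move=> Dc; split=> // K; exists 1 => f M _ _ fM; rewrite mul1r; exact: fM.
Qed.

Lemma is_radon_shift D E c T : (forall x, D x -> E (c + x)) ->
  is_radon D T -> is_radon E (dshift c T).
Proof.
move=> DE [lT bT]; split=> [e f g rf rg|K].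
  by rewrite /dshift lT//; exact: rtest_fun_shift.
have [C CT] := bT (K - c); exists C => f M rf fK fM; apply: CT.
- exact: rtest_fun_shift.
- exact: vanish_gt_shift.
- by move=> x /DE; exact: fM.
Qed.

End radon_measures.

Notation is_radon_ge a := (is_radon [set x | a <= x]).

Section radon_convolution.
Variable R : realType.
Local Notation pdistr := (pdistr R).
Implicit Types (f g : R -> R) (a b c K x : R) (S T : pdistr).

Definition correlation T f : R -> R := fun x => T (fun y => f (x + y)).

Definition rconv S T : pdistr := fun f => S (correlation T f).

Lemma is_derive_correlation a T f x : is_radon_ge a T -> rtest_fun f ->
  is_derive x 1 (correlation T f) (correlation T (derive1 f) x).
Proof.
move=> mT rf; have [sf [K fK]] := rf; have [_ bT] := mT.
have rf' := rtest_fun_derive1 rf; have f'K := vanish_gt_derive1 fK.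
have [M fM] := rtest_fun_bounded (a + x - 1) (rtest_fun_derive1 rf').
have [C CT] := bT (K - x + 1).
apply: (@is_derive_quadratic_remainder _ _ _ _ (C * M) 1) => // h h1.
have rx := rtest_fun_shift x rf; have rxh := rtest_fun_shift (x + h) rf.
have rx' := @rtest_funZ _ h _ (rtest_fun_shift x rf').
have rh := rtest_funB rxh rx.
have -> : correlation T f (x + h) - correlation T f x
    - h * correlation T (derive1 f) x =
    T (fun y => (f (x + h + y) - f (x + y)) - h * derive1 f (x + y)).
  rewrite (radonB mT rh rx') (radonZ _ mT (rtest_fun_shift x rf')).
  by rewrite (radonB mT rxh rx).
rewrite -mulrA; apply: CT; first exact: rtest_funB rh rx'.
- move: h1; rewrite ltr_norml => /andP[h1 h2] y Ky.
  by rewrite !fK ?f'K ?mulr0 ?subr0//; lra.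
- move=> y /= ay; have -> : x + h + y = x + y + h by rewrite addrAC.
  apply: smooth_Taylor1 => // z xyz; apply: fM; apply: le_trans xyz.
  by have := ltW h1; lra.
Qed.

Lemma vanish_gt_correlation a T K f : is_radon_ge a T -> rtest_fun f ->
  vanish_gt K f -> vanish_gt (K - a) (correlation T f).
Proof.
move=> mT rf fK x Kx; apply: (radon_eq0 mT); first exact: rtest_fun_shift.
by move=> y /= ay; apply: fK; lra.
Qed.

Lemma rtest_fun_correlation a T f : is_radon_ge a T -> rtest_fun f ->
  rtest_fun (correlation T f).
Proof.
move=> mT rf; split; last first.
  by have [_ [K fK]] := rf; exists (K - a); exact: vanish_gt_correlation.
apply: (smooth_derive_stable (S := correlation T @` @rtest_fun R));
  last by exists f.
move=> _ [g rg <-]; exists (correlation T (derive1 g)).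
  by exists (derive1 g); first exact: rtest_fun_derive1.
by move=> x; exact: is_derive_correlation mT rg.
Qed.

Lemma is_radon_conv a b S T : is_radon_ge a S -> is_radon_ge b T ->
  is_radon_ge (a + b) (rconv S T).
Proof.
move=> mS mT; split=> [c f g rf rg|K].
  have rcf := rtest_fun_correlation mT rf.
  have rcg := rtest_fun_correlation mT rg.
  rewrite /rconv -mS.1//; congr S; apply/funext => x.
  by rewrite /correlation mT.1//; exact: rtest_fun_shift.
have [A AS] := mS.2 (K - b); have [B BT] := mT.2 (K - a).
exists (A * B) => f M rf fK fM; rewrite -mulrA; apply: AS.
- exact: (rtest_fun_correlation mT).
- exact: vanish_gt_correlation.
- move=> x /= ax; apply: BT; first exact: rtest_fun_shift.
    by apply: vanish_gtW (vanish_gt_shift fK); rewrite lerD2l lerN2.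
  by move=> y yb; apply: fM; exact: lerD.
Qed.

End radon_convolution.

Section radon_distributions.
Variable R : realType.
Local Notation pdistr := (pdistr R).
Implicit Types (D : set R) (phi chi h : R -> R) (a b K : R) (S T : pdistr).

Lemma test_fun_mul chi h : test_fun chi -> smooth h ->
  test_fun (fun x => chi x * h x).
Proof.
move=> [sc [K cK]] sh; split; first exact: smoothM.
by exists K => x /cK ->; rewrite mul0r.
Qed.

Lemma test_funB phi chi : test_fun phi -> test_fun chi ->
  test_fun (fun x => phi x - chi x).
Proof.
move=> [sf [K fK]] [sg [L gL]]; split.
  have := @smooth_lin _ (-1) _ _ sg sf; congr smooth.
  by apply/funext => x; rewrite mulN1r addrC.
exists (Num.max K L) => x; rewrite gt_max => /andP[/fK -> /gL ->].
by rewrite subr0.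
Qed.

Lemma test_fun_shift x phi : test_fun phi -> test_fun (fun y => phi (x + y)).
Proof.
move=> [sf [K fK]]; split; first exact: smooth_shift.
exists (K + `|x|) => y Ky; apply: fK.
have yx : `|y| <= `|x + y| + `|x|.
  by rewrite -{1}(addKr x y) (le_trans (ler_normD _ _))// normrN addrC.
lra.
Qed.

Lemma radon_is_distr D T : is_radon D T -> is_distr T.
Proof.
move=> [lT bT]; split=> [c f g tf tg|K].
  by apply: lT; exact: test_fun_rtest.
have [C CT] := bT K; exists 0%N, C => phi M tphi sphi phiM.
rewrite big_nat1; apply: CT; first exact: test_fun_rtest.
  exact: supported_vanish_gt.
by move=> x _; have := phiM 0%N x (leqnn 0); rewrite derive1n0.
Qed.

Lemma radon_supp_ge a T : is_radon_ge a T -> supp_ge a T.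
Proof.
move=> mT phi tphi [e [e0 phie]]; apply: (radon_eq0 mT).
  exact: test_fun_rtest.
by move=> x /= ax; apply: phie; lra.
Qed.

Lemma radon_in_Dplus a T : is_radon_ge a T -> in_Dplus T.
Proof.
move=> mT; split; first exact: radon_is_distr mT.
by exists a; exact: radon_supp_ge.
Qed.

Lemma radon_in_Eminus a T : a <= 0 -> is_radon `[a, 0] T -> in_Eminus T.
Proof.
move=> a0 mT; split; first exact: radon_is_distr mT.
exists a; split=> // phi tphi [e [e0 phie]]; apply: (radon_eq0 mT).
  exact: test_fun_rtest.
by move=> x; rewrite /= in_itv/= => /andP[ax x0]; apply: phie; lra.
Qed.

Lemma supp_ge_deq a S T : deq S T -> supp_ge a S -> supp_ge a T.
Proof. by move=> ST sS phi tphi phi0; rewrite -ST//; exact: sS. Qed.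

Lemma supp_ge_vanish_correlation b K T phi : supp_ge b T -> test_fun phi ->
  vanish_gt K phi -> vanish_gt (K - b) (correlation T phi).
Proof.
move=> sT tphi phiK x Kx; apply: sT; first exact: test_fun_shift.
exists ((x - (K - b)) / 2); split; first by lra.
by move=> y xy; apply: phiK; lra.
Qed.

Lemma supp_ge_eq a T phi chi : is_distr T -> supp_ge a T ->
  test_fun phi -> test_fun chi -> (forall x, a - 1 <= x -> phi x = chi x) ->
  T phi = T chi.
Proof.
move=> [lT _] sT tphi tchi eq_phi.
have tB := test_funB tphi tchi.
have phiE : phi = (fun x => 1 * (phi x - chi x) + chi x).
  by apply/funext => x; rewrite mul1r subrK.
rewrite [in LHS]phiE lT// sT ?mulr0 ?add0r//; exists 1; split=> //.
by move=> x /eq_phi ->; rewrite subrr.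
Qed.

Lemma radon_cutoff a b K T h chi : is_radon_ge a T -> supp_ge b T ->
  rtest_fun h -> vanish_gt K h -> test_fun chi ->
  (forall x, b - 1 <= x <= K -> chi x = 1) -> T (fun x => chi x * h x) = T h.
Proof.
move=> mT sT rh hK tchi chi1.
have [chi' tchi' chi'1] := test_fun_cutoff (Num.min a b - 1) K.
have ma : Num.min a b <= a by rewrite ge_min lexx.
have mb : Num.min a b <= b by rewrite ge_min lexx orbT.
have tch : test_fun (fun x => chi x * h x) := test_fun_mul tchi rh.1.
have tch' : test_fun (fun x => chi' x * h x) := test_fun_mul tchi' rh.1.
rewrite (supp_ge_eq (radon_is_distr mT) sT tch tch'); last first.
  move=> x bx; have [xK|Kx] := leP x K; last by rewrite hK// !mulr0.
  by rewrite chi1 ?chi'1//; apply/andP; split; lra.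
apply: (radon_eq mT) => //; first exact: test_fun_rtest.
move=> x /= ax; have [xK|Kx] := leP x K; last by rewrite hK// mulr0.
by rewrite chi'1 ?mul1r//; apply/andP; split; lra.
Qed.

Lemma conv_rel_rconv a b S T S0 T0 : is_radon_ge a S0 -> is_radon_ge b T0 ->
  deq S S0 -> deq T T0 -> conv_rel S T (rconv S0 T0).
Proof.
move=> mS mT SS TT a' b' K phi chi sS sT tphi phiK tchi chi1.
have rh := rtest_fun_correlation mT (test_fun_rtest tphi).
have -> : (fun x => chi x * T (fun y => phi (x + y))) =
    (fun x => chi x * correlation T0 phi x).
  by apply/funext => x; rewrite TT//; exact: test_fun_shift.
rewrite SS; last exact: (test_fun_mul tchi rh.1).
apply/esym/(radon_cutoff (K := K - b') mS (supp_ge_deq SS sS)) => //.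
- apply: (supp_ge_vanish_correlation (supp_ge_deq TT sT) tphi).
  exact: supported_vanish_gt.
- by move=> x /andP[ax xK]; apply: chi1; apply/andP; split; lra.
Qed.

Lemma conv_rconv a b S T S0 T0 : is_radon_ge a S0 -> is_radon_ge b T0 ->
  deq S S0 -> deq T T0 -> deq (conv S T) (rconv S0 T0).
Proof.
move=> mS mT SS TT phi tphi.
have cST := conv_rel_rconv mS mT SS TT.
have cU : conv_rel S T (conv S T).
  by apply: epsilon_spec; exists (rconv S0 T0).
have [_ [K phiK]] := tphi.
have [chi tchi chi1] := test_fun_cutoff (a - 1) (K - b + 1).
have sS : supp_ge a S.
  by apply: supp_ge_deq (radon_supp_ge mS) => ? ?; rewrite SS.
have sT : supp_ge b T.
  by apply: supp_ge_deq (radon_supp_ge mT) => ? ?; rewrite TT.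
rewrite (cU _ _ _ _ _ sS sT tphi phiK tchi chi1).
by rewrite (cST _ _ _ _ _ sS sT tphi phiK tchi chi1).
Qed.

Definition represents_radon T := exists a T0, is_radon_ge a T0 /\ deq T T0.

Lemma represents_radon_point_mass x : represents_radon (point_mass x).
Proof.
by exists x, (point_mass x); split=> //; apply: is_radon_point_mass => /=.
Qed.

Lemma represents_radonZ c T : represents_radon T ->
  represents_radon (dscale c T).
Proof.
move=> [a [T0 [mT TT]]]; exists a, (dscale c T0); split; first exact: is_radonZ.
by move=> phi tphi; rewrite /dscale TT.
Qed.

Lemma represents_radonD S T :
  represents_radon S -> represents_radon T -> represents_radon (dadd S T).
Proof.
move=> [a [S0 [mS SS]]] [b [T0 [mT TT]]]; exists (Num.min a b), (dadd S0 T0).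
split; last by move=> phi tphi; rewrite /dadd SS// TT.
apply: is_radonD; [apply: is_radonS mS|apply: is_radonS mT] => x /=.
  by move=> ax; rewrite ge_min ax.
by move=> bx; rewrite ge_min bx orbT.
Qed.

Lemma represents_radon_conv S T :
  represents_radon S -> represents_radon T -> represents_radon (conv S T).
Proof.
move=> [a [S0 [mS SS]]] [b [T0 [mT TT]]]; exists (a + b), (rconv S0 T0).
by split; [exact: is_radon_conv|exact: conv_rconv mS mT SS TT].
Qed.

Lemma represents_radon_order_zero T : represents_radon T -> order_zero T.
Proof.
move=> [a [T0 [[_ bT] TT]]] K; have [C CT] := bT K.
exists C => phi M tphi sphi phiM; rewrite TT//.
by apply: CT => //; [exact: test_fun_rtest|exact: supported_vanish_gt].
Qed.

Lemma dmx_det_order_zero n (M : dmx R n n) :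
  (forall i j, represents_radon (M i j)) -> order_zero (dmx_det M).
Proof.
move=> mM; apply: represents_radon_order_zero;
  apply: (big_ind represents_radon).
- by exists 0, (@dzero R); split; first exact: is_radon0.
- exact: represents_radonD.
- move=> s _; apply/represents_radonZ/(big_ind represents_radon).
  + exact: represents_radon_point_mass.
  + exact: represents_radon_conv.
  + by move=> i _; exact: mM.
Qed.

End radon_distributions.

(** * Matrices of measures and the Neumann series *)

Definition radon_mx (R : realType) n p (D : set R) (S : dmx R n p) :=
  forall i j, is_radon D (S i j).

Notation radon_mx_ge a := (radon_mx [set x | a <= x]).

Section radon_matrices.
Variable R : realType.
Implicit Types (f : R -> R) (a b c : R) (D : set R) (n p r s : nat).

Definition dmx_rconv n p r (S : dmx R n p) (T : dmx R p r) : dmx R n r :=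
  fun i j => \big[@dadd R/@dzero R]_(k < p) rconv (S i k) (T k j).

Definition dmx_lin n p c (S T : dmx R n p) : dmx R n p :=
  fun i j => dadd (dscale c (S i j)) (T i j).

Definition dmx_add n p (S T : dmx R n p) := dmx_lin 1 S T.

Definition dmx_sub n p (S T : dmx R n p) := dmx_lin (-1) T S.

Definition dmx_shift n p c (S : dmx R n p) : dmx R n p :=
  fun i j => dshift c (S i j).

Definition dmx_point_mass n p (B : 'M[R]_(n, p)) : dmx R n p :=
  fun i j => dscale (B i j) (@delta0 R).

Definition dmx_rdeq n p (S T : dmx R n p) :=
  forall i j f, rtest_fun f -> S i j f = T i j f.

Lemma dmx_rdeq_eq n p (S T : dmx R n p) : dmx_rdeq S T -> dmx_eq S T.
Proof. by move=> ST i j f /test_fun_rtest; exact: ST. Qed.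

Lemma big_daddE (I : Type) (r : seq I) (P : pred I) (T : I -> pdistr R) f :
  (\big[@dadd R/@dzero R]_(i <- r | P i) T i) f = \sum_(i <- r | P i) T i f.
Proof. exact: (big_morph (fun S : pdistr R => S f)). Qed.

Lemma dmx_rconvE n p r (S : dmx R n p) (T : dmx R p r) i j f :
  dmx_rconv S T i j f = \sum_k S i k (correlation (T k j) f).
Proof. exact: big_daddE. Qed.

Lemma dmx_addE n p (S T : dmx R n p) i j f :
  dmx_add S T i j f = S i j f + T i j f.
Proof. by rewrite /dmx_add /dmx_lin /dadd /dscale mul1r. Qed.

Lemma dmx_subE n p (S T : dmx R n p) i j f :
  dmx_sub S T i j f = S i j f - T i j f.
Proof. by rewrite /dmx_sub /dmx_lin /dadd /dscale mulN1r addrC. Qed.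

Lemma radon_mx_lin n p D c (S T : dmx R n p) :
  radon_mx D S -> radon_mx D T -> radon_mx D (dmx_lin c S T).
Proof. by move=> mS mT i j; apply: is_radonD => //; exact: is_radonZ. Qed.

Lemma radon_mx_add n p D (S T : dmx R n p) :
  radon_mx D S -> radon_mx D T -> radon_mx D (dmx_add S T).
Proof. exact: radon_mx_lin. Qed.

Lemma radon_mx_sub n p D (S T : dmx R n p) :
  radon_mx D S -> radon_mx D T -> radon_mx D (dmx_sub S T).
Proof. by move=> mS mT; exact: radon_mx_lin. Qed.

Lemma radon_mx_shift n p D E c (S : dmx R n p) : (forall x, D x -> E (c + x)) ->
  radon_mx D S -> radon_mx E (dmx_shift c S).
Proof. by move=> DE mS i j; exact: is_radon_shift DE _. Qed.

Lemma radon_mx_point_mass n p D (B : 'M[R]_(n, p)) :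
  D 0 -> radon_mx D (dmx_point_mass B).
Proof. by move=> D0 i j; apply/is_radonZ/is_radon_point_mass. Qed.

Lemma dmx_deltaIE n : @dmx_deltaI R n = dmx_point_mass 1%:M.
Proof.
apply/funext => i; apply/funext => j; apply/funext => f.
by rewrite /dmx_deltaI /dmx_point_mass /dscale mxE; case: (i == j);
  rewrite ?mul1r ?mul0r.
Qed.

Lemma radon_mx_deltaI n D : D 0 -> radon_mx D (@dmx_deltaI R n).
Proof. by rewrite dmx_deltaIE; exact: radon_mx_point_mass. Qed.

Lemma radon_mx_conv n p r a b (S : dmx R n p) (T : dmx R p r) :
  radon_mx_ge a S -> radon_mx_ge b T ->
  radon_mx_ge (a + b) (dmx_rconv S T).
Proof.
by move=> mS mT i j; apply: is_radon_sum => k _; exact: is_radon_conv.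
Qed.

Lemma dmx_rconvA n p r s a b c (S : dmx R n p) (T : dmx R p r) (U : dmx R r s) :
  radon_mx_ge a S -> radon_mx_ge b T ->
  radon_mx_ge c U ->
  dmx_rdeq (dmx_rconv (dmx_rconv S T) U) (dmx_rconv S (dmx_rconv T U)).
Proof.
move=> mS mT mU i j f rf; rewrite !dmx_rconvE.
under eq_bigr do rewrite dmx_rconvE.
rewrite exchange_big/=; apply: eq_bigr => k _.
have rTU l : rtest_fun (correlation (T k l) (correlation (U l j) f)).
  exact: rtest_fun_correlation (mT k l) (rtest_fun_correlation (mU l j) rf).
rewrite -(radon_sum _ (mS i k) rTU); congr (S i k); apply/funext => x.
rewrite /correlation dmx_rconvE; apply: eq_bigr => l _.
congr (T k l); apply/funext => y; congr (U l j); apply/funext => z.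
by rewrite addrA.
Qed.

Lemma dmx_rconv_rdeqr n p r (S : dmx R n p) (T U : dmx R p r) :
  dmx_rdeq T U -> dmx_rdeq (dmx_rconv S T) (dmx_rconv S U).
Proof.
move=> TU i j f rf; rewrite !dmx_rconvE; apply: eq_bigr => k _.
congr (S i k); apply/funext => x.
by apply: TU; exact: rtest_fun_shift.
Qed.

Lemma dmx_rconv_rdeql n p r a (S U : dmx R n p) (T : dmx R p r) :
  radon_mx_ge a T -> dmx_rdeq S U ->
  dmx_rdeq (dmx_rconv S T) (dmx_rconv U T).
Proof.
move=> mT SU i j f rf; rewrite !dmx_rconvE; apply: eq_bigr => k _.
by apply: SU; exact: rtest_fun_correlation (mT k j) rf.
Qed.

Lemma dmx_rconv_deltal n p (T : dmx R n p) :
  dmx_rdeq (dmx_rconv (@dmx_deltaI R n) T) T.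
Proof.
move=> i j f _; rewrite dmx_rconvE (bigD1 i)//= big1 => [|k ki].
  rewrite /dmx_deltaI eqxx addr0; congr (T i j).
  by apply/funext => y; rewrite add0r.
by rewrite /dmx_deltaI eq_sym (negPf ki).
Qed.

Lemma dmx_rconv_deltar a n p (T : dmx R n p) : radon_mx_ge a T ->
  dmx_rdeq (dmx_rconv T (@dmx_deltaI R p)) T.
Proof.
move=> mT i j f _; rewrite dmx_rconvE (bigD1 j)//= big1 => [|k kj].
  rewrite /dmx_deltaI /correlation eqxx addr0; congr (T i j).
  by apply/funext => y; rewrite /delta0 addr0.
rewrite /dmx_deltaI (negPf kj) -[RHS](radon0 (mT i k)).
by congr (T i k).
Qed.

Lemma dmx_rconv_linl c n p r (S U : dmx R n p) (T : dmx R p r) i j f :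
  dmx_rconv (dmx_lin c S U) T i j f =
  dmx_lin c (dmx_rconv S T) (dmx_rconv U T) i j f.
Proof.
rewrite /dmx_lin /dadd /dscale !dmx_rconvE mulr_sumr -big_split.
exact: eq_bigr.
Qed.

Lemma dmx_rconv_linr a b c n p r (S : dmx R n p) (T U : dmx R p r) :
  radon_mx_ge a S -> radon_mx_ge b T ->
  radon_mx_ge b U ->
  dmx_rdeq (dmx_rconv S (dmx_lin c T U))
           (dmx_lin c (dmx_rconv S T) (dmx_rconv S U)).
Proof.
move=> mS mT mU i j f rf; rewrite /dmx_lin /dadd /dscale !dmx_rconvE.
rewrite mulr_sumr -big_split; apply: eq_bigr => k _ /=.
have rT := rtest_fun_correlation (mT k j) rf.
have rU := rtest_fun_correlation (mU k j) rf.
by rewrite -(mS i k).1.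
Qed.

Lemma dmx_rconvDl n p r (S U : dmx R n p) (T : dmx R p r) i j f :
  dmx_rconv (dmx_add S U) T i j f =
  dmx_add (dmx_rconv S T) (dmx_rconv U T) i j f.
Proof. exact: dmx_rconv_linl. Qed.

Lemma dmx_rconvBl n p r (S U : dmx R n p) (T : dmx R p r) i j f :
  dmx_rconv (dmx_sub S U) T i j f =
  dmx_sub (dmx_rconv S T) (dmx_rconv U T) i j f.
Proof. exact: dmx_rconv_linl. Qed.

Lemma dmx_rconvDr a b n p r (S : dmx R n p) (T U : dmx R p r) :
  radon_mx_ge a S -> radon_mx_ge b T ->
  radon_mx_ge b U ->
  dmx_rdeq (dmx_rconv S (dmx_add T U))
    (dmx_add (dmx_rconv S T) (dmx_rconv S U)).
Proof. exact: dmx_rconv_linr. Qed.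

Lemma dmx_rconvBr a b n p r (S : dmx R n p) (T U : dmx R p r) :
  radon_mx_ge a S -> radon_mx_ge b T ->
  radon_mx_ge b U ->
  dmx_rdeq (dmx_rconv S (dmx_sub T U))
    (dmx_sub (dmx_rconv S T) (dmx_rconv S U)).
Proof. by move=> mS mT mU; exact: dmx_rconv_linr mS mU mT. Qed.

Lemma dmx_rconv_shift b c n p r (S : dmx R n p) (T : dmx R p r) i j f :
  dmx_rconv (dmx_shift b S) (dmx_shift c T) i j f =
  dmx_shift (b + c) (dmx_rconv S T) i j f.
Proof.
rewrite /dmx_shift /dshift !dmx_rconvE; apply: eq_bigr => k _.
congr (S i k); apply/funext => x; congr (T k j); apply/funext => y.
by rewrite addrACA.
Qed.

Lemma dmx_shift0 n p (S : dmx R n p) : dmx_shift 0 S = S.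
Proof.
apply/funext => i; apply/funext => j; apply/funext => f.
by congr (S i j); apply/funext => x; rewrite add0r.
Qed.

Lemma dmx_conv_rconv n p r a b (M M0 : dmx R n p) (N N0 : dmx R p r) :
  radon_mx_ge a M0 -> radon_mx_ge b N0 ->
  dmx_eq M M0 -> dmx_eq N N0 -> dmx_eq (dmx_conv M N) (dmx_rconv M0 N0).
Proof.
move=> mM mN MM NN i j phi tphi; rewrite /dmx_conv /dmx_rconv !big_daddE.
by apply: eq_bigr => k _; exact: (conv_rconv (mM i k) (mN k j)).
Qed.

End radon_matrices.

Section exponential_norm.
Variable R : realType.
Implicit Types (f : R -> R) (K M lam c e : R) (S T : pdistr R).

Definition exp_dominated lam M f :=
  forall x, 0 <= x -> `|f x| <= M * expR (- (lam * x)).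

(* For a measure [T] carried by [[0, +oo[], this says that [e^(- lam t)] has
   integral at most [c] against the variation of [T], a submultiplicative
   norm. *)
Definition exp_bounded lam c T :=
  forall f M, rtest_fun f -> exp_dominated lam M f -> `|T f| <= c * M.

Lemma exp_dominated_ge0 lam M f : exp_dominated lam M f -> 0 <= M.
Proof.
move=> /(_ 0 (lexx _))/(le_trans (normr_ge0 _)).
by rewrite mulr0 oppr0 expR0 mulr1.
Qed.

Lemma exp_dominated_shift lam M f x : 0 <= x -> exp_dominated lam M f ->
  exp_dominated lam (M * expR (- (lam * x))) (fun y => f (x + y)).
Proof.
move=> x0 fM y y0; rewrite -mulrA -expRD -opprD -mulrDr.
by apply: fM; exact: addr_ge0.
Qed.

Lemma vanish_gt_exp_dominated lam K M f : 0 <= lam -> vanish_gt K f ->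
  (forall x, 0 <= x -> `|f x| <= M) ->
  exp_dominated lam (M * expR (lam * `|K|)) f.
Proof.
move=> lam0 fK fM x x0; have M0 : 0 <= M by exact: le_trans (fM _ x0).
have [xK|Kx] := leP x K; last by rewrite fK// normr0 !mulr_ge0 ?expR_ge0.
apply: (le_trans (fM _ x0)); rewrite -mulrA -expRD ler_peMr//.
by rewrite -expR0 ler_expR -mulrBr mulr_ge0// subr_ge0 (le_trans xK)// ler_norm.
Qed.

Lemma rtest_fun_exp_dominated lam f : 0 <= lam -> rtest_fun f ->
  exists M, exp_dominated lam M f.
Proof.
move=> lam0 rf; have [_ [K fK]] := rf; have [M fM] := rtest_fun_bounded 0 rf.
by exists (M * expR (lam * `|K|)); exact: vanish_gt_exp_dominated.
Qed.

Lemma exp_boundedW lam c e T : c <= e -> exp_bounded lam c T ->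
  exp_bounded lam e T.
Proof.
move=> ce bT f M rf fM; apply: (le_trans (bT f M rf fM)).
by rewrite ler_wpM2r ?(exp_dominated_ge0 fM).
Qed.

Lemma exp_bounded_rdeq lam c S T : (forall f, rtest_fun f -> S f = T f) ->
  exp_bounded lam c T -> exp_bounded lam c S.
Proof. by move=> ST bT f M rf fM; rewrite ST//; exact: bT. Qed.

Lemma exp_bounded0 lam : exp_bounded lam 0 (@dzero R).
Proof. by move=> f M _ _; rewrite normr0 mul0r. Qed.

Lemma exp_boundedD lam c e S T : exp_bounded lam c S -> exp_bounded lam e T ->
  exp_bounded lam (c + e) (dadd S T).
Proof.
move=> bS bT f M rf fM.
by rewrite (le_trans (ler_normD _ _))// mulrDl lerD ?bS ?bT.
Qed.

Lemma exp_boundedZ lam c e T : exp_bounded lam c T ->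
  exp_bounded lam (`|e| * c) (dscale e T).
Proof.
by move=> bT f M rf fM; rewrite /dscale normrM -mulrA ler_wpM2l// bT.
Qed.

Lemma exp_bounded_point_mass lam c : 0 <= c ->
  exp_bounded lam (expR (- (lam * c))) (point_mass c).
Proof. by move=> c0 f M _ /(_ _ c0); rewrite mulrC. Qed.

Lemma exp_bounded_rconv a lam c e S T : is_radon_ge a T ->
  exp_bounded lam c S -> exp_bounded lam e T ->
  exp_bounded lam (c * e) (rconv S T).
Proof.
move=> mT bS bT f M rf fM; rewrite -mulrA.
apply: bS; first exact: rtest_fun_correlation mT rf.
move=> x x0; rewrite -mulrA; apply: bT; first exact: rtest_fun_shift.
exact: exp_dominated_shift.
Qed.

Lemma exp_bounded_dmx_rconv a lam c e n p r (S : dmx R n p) (T : dmx R p r) :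
  radon_mx_ge a T -> (forall i k, exp_bounded lam c (S i k)) ->
  (forall k j, exp_bounded lam e (T k j)) ->
  forall i j, exp_bounded lam (p%:R * (c * e)) (dmx_rconv S T i j).
Proof.
move=> mT bS bT i j f M rf fM; rewrite /dmx_rconv big_daddE.
apply: (le_trans (ler_norm_sum _ _ _)).
rewrite -mulrA mulr_natl -[in leRHS](card_ord p) -sumr_const.
by apply: ler_sum => k _; exact: (exp_bounded_rconv (mT k j)).
Qed.

Lemma exp_bounded_deltaI lam n (i j : 'I_n) :
  exp_bounded lam 1 (@dmx_deltaI R n i j).
Proof.
move=> f M rf fM; rewrite mul1r /dmx_deltaI; case: (i == j).
  by have := fM 0 (lexx _); rewrite mulr0 oppr0 expR0 mulr1.
by rewrite /dzero normr0 (exp_dominated_ge0 fM).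
Qed.

Lemma exp_bounded_dmx_sub lam c e n p (S T : dmx R n p) i j :
  exp_bounded lam c (S i j) -> exp_bounded lam e (T i j) ->
  exp_bounded lam (c + e) (dmx_sub S T i j).
Proof.
move=> bS bT f M rf fM; rewrite dmx_subE (le_trans (ler_normB _ _))//.
by rewrite mulrDl lerD ?bS ?bT.
Qed.

Lemma exp_bounded_halves_eq0 lam c T f : 0 <= lam ->
  (forall n, exp_bounded lam (c / 2 ^+ n) T) -> rtest_fun f -> T f = 0.
Proof.
move=> lam0 bT rf; have [M fM] := rtest_fun_exp_dominated lam0 rf.
have cM0 : c * M / 2 ^+ n @[n --> \oo] --> (0 : R).
  under eq_fun do rewrite -exprVn.
  by apply: (@cvg_geometric _ (c * M) 2^-1); rewrite ger0_norm; lra.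
apply/eqP; rewrite -normr_le0; apply: (cvgr_to_ge cM0).
by apply: nearW => n; rewrite mulrAC; exact: bT.
Qed.

(* The measures without mass at the origin, by dominated convergence. *)
Definition exp_negligible T :=
  forall e, 0 < e -> \forall lam \near +oo, exp_bounded lam e T.

Lemma exp_negligibleD S T :
  exp_negligible S -> exp_negligible T -> exp_negligible (dadd S T).
Proof.
move=> nS nT e e0; have e20 : 0 < e / 2 by lra.
near=> lam; rewrite [e]splitr; apply: exp_boundedD.
- by near: lam; exact: nS.
- by near: lam; exact: nT.
Unshelve. all: by end_near. Qed.

Lemma exp_negligibleZ c T : exp_negligible T -> exp_negligible (dscale c T).
Proof.
move=> nT e e0; have c1 : 0 < `|c| + 1 by rewrite ltr_pwDr.
near=> lam; have : exp_bounded lam (e / (`|c| + 1)) T.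
  by near: lam; apply: nT; rewrite divr_gt0.
move/(@exp_boundedZ _ _ c); apply: exp_boundedW.
by rewrite mulrCA ger_pMr// ler_pdivrMr// mul1r lerDl.
Unshelve. all: by end_near. Qed.

Lemma exp_negligible_sum (I : Type) (r : seq I) (P : pred I)
    (T : I -> pdistr R) :
  (forall i, P i -> exp_negligible (T i)) ->
  exp_negligible (\big[@dadd R/@dzero R]_(i <- r | P i) T i).
Proof.
apply: big_ind; last exact: exp_negligibleD.
move=> e e0; apply: nearW => lam.
exact: exp_boundedW (ltW e0) (@exp_bounded0 lam).
Qed.

Lemma exp_negligible_point_mass c : 0 < c -> exp_negligible (point_mass c).
Proof.
move=> c0 e e0; near=> lam; have ec0 : 0 < e * c by exact: mulr_gt0.
have lam_ge : (e * c)^-1 <= lam by near: lam; exact/nbhs_pinfty_ge/num_real.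
have lam0 : 0 < lam by rewrite (lt_le_trans _ lam_ge)// invr_gt0.
apply: exp_boundedW (@exp_bounded_point_mass lam c (ltW c0)).
rewrite expRN invf_ple ?posrE ?expR_gt0//.
have lamc : e^-1 <= lam * c by rewrite -ler_pdivrMr// -invfM.
by rewrite (le_trans lamc)// (le_trans _ (expR_ge1Dx _))// lerDr.
Unshelve. all: by end_near. Qed.

End exponential_norm.

Lemma cvg_of_halving_increments (R : realType) (u : R ^nat) M :
  (forall n, `|u n.+1 - u n| <= M / 2 / 2 ^+ n) ->
  cvgn u /\ forall n, `|limn u - u n| <= M / 2 ^+ n.
Proof.
move=> uM; have M0 : 0 <= M.
  by have := le_trans (normr_ge0 _) (uM 0%N); rewrite expr0; lra.
have cu : cvgn u.
  rewrite (_ : u = (fun n => u 0%N + series (telescope u) n)); last first.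
    by apply/funext => n; rewrite -eq_sum_telescope.
  apply: is_cvgD; first exact: is_cvg_cst.
  apply: normed_cvg.
  apply: (@series_le_cvg _ _ (geometric (M / 2) 2^-1)) => [n|n|n|].
  - exact: normr_ge0.
  - by rewrite /geometric/= mulr_ge0 ?divr_ge0// exprn_ge0// invr_ge0.
  - by rewrite /geometric/= exprVn; exact: uM.
  - by apply: is_cvg_geometric_series; rewrite ger0_norm; lra.
split=> // n.
have tail m : `|u (m + n)%N - u n| <= M / 2 ^+ n - M / 2 ^+ (m + n).
  elim: m => [|m IHm]; first by rewrite add0n !subrr normr0.
  rewrite addSn (le_trans (ler_distD (u (m + n)%N) _ _))//.
  rewrite (le_trans (lerD (uM _) IHm))// le_eqVlt; apply/orP; left; apply/eqP.
  by rewrite exprS; field; rewrite !expf_neq0.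
have cl : `|u (m + n)%N - u n| @[m --> \oo] --> `|limn u - u n|.
  apply: cvg_norm; apply: cvgB; last exact: cvg_cst.
  by rewrite (cvg_shiftn n u).
apply: (cvgr_to_le cl); apply: nearW => m; apply: (le_trans (tail m)).
by rewrite gerBl divr_ge0// exprn_ge0.
Qed.

Section neumann_series.
Variables (R : realType) (d : nat) (k : dmx R d d).
Local Notation delta := (@dmx_deltaI R d).
Implicit Types (f : R -> R) (M : R) (n : nat).

Fixpoint neumann_sum n : dmx R d d :=
  if n is m.+1 then dmx_add (dmx_rconv k (neumann_sum m)) delta else delta.

Definition neumann : dmx R d d :=
  fun i j f => limn (fun n => neumann_sum n i j f).

Hypothesis k_radon : radon_mx_ge 0 k.

Let delta_radon : radon_mx_ge 0 delta.
Proof. by apply: radon_mx_deltaI => /=. Qed.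

Lemma radon_mx_neumann_sum n : radon_mx_ge 0 (neumann_sum n).
Proof.
elim: n => [|n IHn] //=; apply: radon_mx_add => //.
by have := radon_mx_conv k_radon IHn; rewrite addr0.
Qed.

Lemma neumann_sumSr n : dmx_rdeq (neumann_sum n.+1)
  (dmx_add (dmx_rconv (neumann_sum n) k) delta).
Proof.
elim: n => [|n IHn] i j f rf.
  by rewrite /= !dmx_addE dmx_rconv_deltal// (dmx_rconv_deltar k_radon).
have mS := radon_mx_neumann_sum n.
have mSk : radon_mx_ge 0 (dmx_rconv (neumann_sum n) k).
  by have := radon_mx_conv mS k_radon; rewrite addr0.
rewrite [LHS]dmx_addE [RHS]dmx_addE; congr (_ + _).
rewrite (dmx_rconv_rdeqr k IHn)//.
rewrite (dmx_rconvDr k_radon mSk delta_radon)// dmx_addE.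
rewrite /= dmx_rconvDl dmx_addE (dmx_rconvA k_radon mS k_radon)//;
  congr (_ + _).
by rewrite dmx_rconv_deltal// (dmx_rconv_deltar k_radon).
Qed.

Section contraction.
Variables (lam c : R).
Hypotheses (lam_ge0 : 0 <= lam) (c_small : d%:R * c <= 2^-1).
Hypothesis k_bounded : forall i j, exp_bounded lam c (k i j).

Let halve e : 0 <= e -> d%:R * (c * e) <= e / 2.
Proof. by move=> e0; rewrite mulrA [leRHS]mulrC ler_wpM2r. Qed.

Lemma exp_bounded_neumann_sum_step n i j :
  exp_bounded lam (2^-1 / 2 ^+ n)
    (dmx_sub (neumann_sum n.+1) (neumann_sum n) i j).
Proof.
have kS_bounded (T : dmx R d d) e : 0 <= e -> radon_mx_ge 0 T ->
    (forall i j, exp_bounded lam e (T i j)) ->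
    forall i j, exp_bounded lam (e / 2) (dmx_rconv k T i j).
  move=> e0 mT bT i' j'.
  exact: exp_boundedW (halve e0) (exp_bounded_dmx_rconv mT k_bounded bT i' j').
elim: n i j => [|n IHn] i j.
  apply: (@exp_bounded_rdeq _ _ _ _ (dmx_rconv k delta i j)).
    by move=> f _; rewrite dmx_subE /= dmx_addE addrK.
  rewrite expr0 divr1 -[2^-1]mul1r; apply: kS_bounded => // {i j}.
  exact: exp_bounded_deltaI.
have mS m := radon_mx_neumann_sum m.
apply: (exp_bounded_rdeq
  (T := dmx_rconv k (dmx_sub (neumann_sum n.+1) (neumann_sum n)) i j)).
  move=> f rf; rewrite (dmx_rconvBr k_radon (mS _) (mS _))// !dmx_subE.
  by rewrite [in LHS]/= !dmx_addE opprD addrACA subrr addr0.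
rewrite exprSr invfM mulrA; apply: kS_bounded; last exact: IHn.
- by rewrite divr_ge0// exprn_ge0.
- exact: radon_mx_sub.
Qed.

Lemma neumann_sum_increment i j f M : rtest_fun f -> exp_dominated lam M f ->
  forall n, `|neumann_sum n.+1 i j f - neumann_sum n i j f| <= M / 2 / 2 ^+ n.
Proof.
move=> rf fM n; rewrite -dmx_subE -mulrA mulrC.
exact: exp_bounded_neumann_sum_step.
Qed.

Lemma neumann_sum_cvg i j f : rtest_fun f ->
  neumann_sum n i j f @[n --> \oo] --> neumann i j f.
Proof.
move=> rf; have [M fM] := rtest_fun_exp_dominated lam_ge0 rf.
exact: (cvg_of_halving_increments (neumann_sum_increment i j rf fM)).1.
Qed.

Lemma exp_bounded_neumann_tail n i j :
  exp_bounded lam (1 / 2 ^+ n) (dmx_sub neumann (neumann_sum n) i j).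
Proof.
move=> f M rf fM; rewrite dmx_subE mul1r mulrC.
exact: (cvg_of_halving_increments (neumann_sum_increment i j rf fM)).2.
Qed.

Lemma radon_mx_neumann_contraction : radon_mx_ge 0 neumann.
Proof.
move=> i j; split=> [e f g rf rg|K].
  apply: cvg_lim => //.
  under eq_fun do rewrite (radon_mx_neumann_sum _ i j).1//.
  apply: cvgD; last exact: neumann_sum_cvg.
  by apply: cvgM; [exact: cvg_cst|exact: neumann_sum_cvg].
exists (2 * expR (lam * `|K|)) => f M rf fK fM.
have dom := vanish_gt_exp_dominated lam_ge0 fK fM.
have := exp_bounded_neumann_tail 0 i j rf dom.
have := exp_bounded_deltaI i j rf dom.
rewrite dmx_subE expr0 divr1 !mul1r => b1 b2.
rewrite -[neumann i j f](subrK (delta i j f)) (le_trans (ler_normD _ _))//.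
by apply: (le_trans (lerD b2 b1)); lra.
Qed.

Lemma neumann_fixpoint (F : dmx R d d -> dmx R d d) :
  (forall n, dmx_rdeq (neumann_sum n.+1) (dmx_add (F (neumann_sum n)) delta)) ->
  (forall n i j, exp_bounded lam (1 / 2 ^+ n / 2)
     (dmx_sub (F neumann) (F (neumann_sum n)) i j)) ->
  dmx_rdeq neumann (dmx_add (F neumann) delta).
Proof.
move=> FS FN i j f rf; apply/eqP; rewrite -subr_eq0 -dmx_subE; apply/eqP.
apply: (exp_bounded_halves_eq0 (c := 1) lam_ge0 _ rf) => n {f rf}.
apply: (exp_bounded_rdeq (T := dmx_sub (dmx_sub neumann (neumann_sum n.+1))
  (dmx_sub (F neumann) (F (neumann_sum n))) i j)).
  by move=> f rf; rewrite !dmx_subE FS// !dmx_addE; ring.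
have -> : 1 / 2 ^+ n = 1 / 2 ^+ n.+1 + 1 / 2 ^+ n / 2 :> R.
  by rewrite exprS; field; rewrite expf_neq0.
exact: exp_bounded_dmx_sub (exp_bounded_neumann_tail n.+1 i j) (FN n i j).
Qed.

Lemma neumannl_contraction :
  dmx_rdeq neumann (dmx_add (dmx_rconv k neumann) delta).
Proof.
apply: neumann_fixpoint => // n i j.
have mN := radon_mx_neumann_contraction; have mS := radon_mx_neumann_sum n.
apply: (exp_bounded_rdeq
  (T := dmx_rconv k (dmx_sub neumann (neumann_sum n)) i j)).
  by move=> f rf; rewrite (dmx_rconvBr k_radon mN mS).
apply: exp_boundedW (exp_bounded_dmx_rconv _ k_bounded
  (exp_bounded_neumann_tail n) i j).
- by apply: halve; rewrite divr_ge0// exprn_ge0.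
- exact: radon_mx_sub.
Qed.

Lemma neumannr_contraction :
  dmx_rdeq neumann (dmx_add (dmx_rconv neumann k) delta).
Proof.
apply: (neumann_fixpoint (F := fun T => dmx_rconv T k));
  first exact: neumann_sumSr.
move=> n i j.
apply: (exp_bounded_rdeq
  (T := dmx_rconv (dmx_sub neumann (neumann_sum n)) k i j)).
  by move=> f rf; rewrite dmx_rconvBl.
apply: exp_boundedW (exp_bounded_dmx_rconv k_radon (exp_bounded_neumann_tail n)
  k_bounded i j).
by rewrite (mulrC _ c); apply: halve; rewrite divr_ge0// exprn_ge0.
Qed.

End contraction.

Hypothesis k_negligible : forall i j, exp_negligible (k i j).

Lemma exp_contraction : exists lam c, [/\ 0 <= lam, d%:R * c <= 2^-1 &
  forall i j, exp_bounded lam c (k i j)].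
Proof.
pose c : R := 2^-1 / d.+1%:R.
have c0 : 0 < c by rewrite divr_gt0// ltr0n.
have near_bounded : \forall lam \near +oo, forall ij : 'I_d * 'I_d,
    exp_bounded lam c (k ij.1 ij.2).
  by apply: filter_forall => ij; exact: k_negligible.
have [lam [lam_ge0 k_bounded]] :=
  filter_ex (filterI (nbhs_pinfty_ge (num_real 0)) near_bounded).
exists lam, c; split=> // [|i j]; last exact: (k_bounded (i, j)).
by rewrite mulrCA ger_pMr// ler_pdivrMr ?ltr0n// mul1r ler_nat.
Qed.

Lemma radon_mx_neumann : radon_mx_ge 0 neumann.
Proof.
have [lam [c [lam_ge0 c_small k_bounded]]] := exp_contraction.
exact: radon_mx_neumann_contraction lam_ge0 c_small k_bounded.
Qed.

Lemma neumannl : dmx_rdeq (dmx_rconv (dmx_sub delta k) neumann) delta.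
Proof.
have [lam [c [lam_ge0 c_small k_bounded]]] := exp_contraction => i j f rf.
rewrite dmx_rconvBl dmx_subE dmx_rconv_deltal//.
rewrite (neumannl_contraction lam_ge0 c_small k_bounded)// dmx_addE.
by rewrite addrC addKr.
Qed.

Lemma neumannr : dmx_rdeq (dmx_rconv neumann (dmx_sub delta k)) delta.
Proof.
have [lam [c [lam_ge0 c_small k_bounded]]] := exp_contraction => i j f rf.
have mN := radon_mx_neumann.
rewrite (dmx_rconvBr mN delta_radon k_radon)// dmx_subE (dmx_rconv_deltar mN)//.
rewrite (neumannr_contraction lam_ge0 c_small k_bounded)// dmx_addE.
by rewrite addrC addKr.
Qed.

End neumann_series.

(** * Locally integrable functions as measures *)

Section measure_preserving_maps.
Context d (T : measurableType d) (R : realType).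
Variable mu : {measure set T -> \bar R}.
Implicit Types (phi : T -> T) (D : set T).

Definition measure_preserving phi := measurable_fun setT phi /\
  forall A, measurable A -> mu (phi @^-1` A) = mu A.

Lemma ge0_integral_preserving phi (f : T -> \bar R) D :
  measure_preserving phi -> measurable D -> measurable_fun D f ->
  (forall x, D x -> 0 <= f x)%E ->
  (\int[mu]_(x in phi @^-1` D) f (phi x) = \int[mu]_(x in D) f x)%E.
Proof.
move=> [mphi muphi] mD mf f0.
pose phiM : {mfun T >-> T} :=
  HB.pack phi (isMeasurableFun.Build _ _ _ _ _ mphi).
transitivity (\int[pushforward mu phiM]_(x in D) f x)%E; last first.
  by apply: eq_measure_integral => A mA _; exact: muphi.
by rewrite ge0_integral_pushforward// => x; rewrite inE; exact: f0.
Qed.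

Lemma integral_preserving phi (f : T -> \bar R) :
  measure_preserving phi -> measurable_fun setT f ->
  (\int[mu]_x f (phi x) = \int[mu]_x f x)%E.
Proof.
move=> pphi mf; rewrite integralE [RHS]integralE.
rewrite -(@ge0_integral_preserving phi (f ^\+)%E setT)//;
  last exact: measurable_funepos.
rewrite -(@ge0_integral_preserving phi (f ^\-)%E setT)//;
  last exact: measurable_funeneg.
by rewrite preimage_setT; congr (_ - _)%E; apply: eq_integral => x _;
  rewrite ?funeposE ?funenegE.
Qed.

Lemma integrable_preserving phi (f : T -> \bar R) :
  measure_preserving phi -> mu.-integrable setT f ->
  mu.-integrable setT (fun x => f (phi x)).
Proof.
move=> pphi /integrableP[mf foo]; apply/integrableP; split.
  exact: (measurableT_comp mf pphi.1).
have mabs : measurable_fun setT (fun x => `|f x|%E) by exact: measurableT_comp.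
by have := integral_preserving pphi mabs => ->.
Qed.

Lemma Rintegral_preserving phi (f : T -> R) :
  measure_preserving phi -> mu.-integrable setT (EFin \o f) ->
  Rintegral mu setT (fun x => f (phi x)) = Rintegral mu setT f.
Proof.
move=> pphi /integrableP[mf _]; congr fine.
exact: (@integral_preserving phi (EFin \o f)).
Qed.

Lemma ae_preserving phi (P : T -> Prop) : measure_preserving phi ->
  {ae mu, forall x, P x} -> {ae mu, forall x, P (phi x)}.
Proof.
move=> [mphi muphi] [B [mB B0 PB]]; exists (phi @^-1` B); split.
- by rewrite -(setTI (_ @^-1` _)); exact: mphi.
- by rewrite muphi.
- by move=> x /= nP; apply: PB.
Qed.

Lemma ae_eq_Rintegral D (f g : T -> R) : measurable D ->
  measurable_fun D f -> measurable_fun D g ->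
  {ae mu, forall x, D x -> f x = g x} ->
  Rintegral mu D f = Rintegral mu D g.
Proof.
move=> mD mf mg fg; congr fine; apply: ae_eq_integral => //.
- exact/measurable_EFinP.
- exact/measurable_EFinP.
- by apply: filterS fg => x fgx Dx; rewrite /= fgx.
Qed.

End measure_preserving_maps.

Section lebesgue_invariance.
Variable R : realType.
Local Notation mu := (@lebesgue_measure R).
Implicit Type c : R.

Lemma measure_preserving_shift c : measure_preserving mu (fun x => c + x).
Proof.
pose phi : measurableTypeR R -> measurableTypeR R := fun x => c + x.
have mphi : measurable_fun [set: measurableTypeR R] phi.
  exact: measurable_funD.
split=> // A mA.
pose phiM : {mfun measurableTypeR R >-> measurableTypeR R} :=
  HB.pack phi (isMeasurableFun.Build _ _ _ _ _ mphi).
apply/esym.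
apply: (@lebesgue_measure_unique R (pushforward mu phiM)) mA => X [[a b] _ <-].
have pE : phiM @^-1` `](a, b).1, (a, b).2]%classic = `]a - c, b - c]%classic.
  by apply/seteqP; split=> x /=; rewrite !in_itv/= /phi => /andP[ax xb];
    apply/andP; split; lra.
transitivity (mu `]a - c, b - c]%classic); last by rewrite -pE.
rewrite !lebesgue_measure_itv/= !lte_fin ltrD2r.
by case: ifPn => // _; rewrite -!EFinB; congr EFin; ring.
Qed.

Lemma measure_preserving_reflect c : measure_preserving mu (fun x => c - x).
Proof.
split; first exact: measurable_funB.
move=> A mA; have [mc cA] := measure_preserving_shift c.
rewrite -(cA A mA) -[RHS]lebesgue_measureN//.
by rewrite -(setTI (_ @^-1` _)); exact: mc.
Qed.

End lebesgue_invariance.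

#[local] Instance lebesgue_ae_filter (R : realType) :
  Filter (almost_everywhere (@lebesgue_measure R)) :=
  ae_filter_ringOfSetsType _.

Definition locint_carried (R : realType) (D : set R) (z : R -> R) :=
  locally_integrable setT z /\
  {ae (@lebesgue_measure R), forall t, ~ D t -> z t = 0}.

Notation causal a := (locint_carried [set t | a <= t]).

Section locally_integrable_functions.
Variable R : realType.
Local Notation mu := (@lebesgue_measure R).
Implicit Types (z f : R -> R) (a b c q K M : R) (D : set R).

Lemma locally_integrable_itv z a b :
  locally_integrable setT z -> mu.-integrable `[a, b] (EFin \o z).
Proof.
move=> [mz _ iz]; apply/integrableP; split.
  by apply/measurable_EFinP; exact: measurable_funS mz.
by apply: iz => //; exact: segment_compact.
Qed.

Lemma integrable_itv_locally z : measurable_fun setT z ->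
  (forall a b, mu.-integrable `[a, b] (EFin \o z)) -> locally_integrable setT z.
Proof.
move=> mz iz; split=> //; first exact: openT.
move=> A _ cA; have [M [_ AM]] := compact_bounded cA.
have /integrableP[_] := iz (- (M + 1)) (M + 1); apply: le_lt_trans.
apply: ge0_subset_integral => //.
- exact: compact_measurable.
- apply/measurable_EFinP; apply: measurableT_comp => //.
  exact: measurable_funS mz.
- by move=> x /(AM (M + 1)); rewrite /= in_itv/= -ler_norml ltrDl; apply.
Qed.

Lemma bounded_locally_integrable z M : measurable_fun setT z ->
  (forall t, `|z t| <= M) -> locally_integrable setT z.
Proof.
move=> mz zM; apply: integrable_itv_locally => // a b.
apply: measurable_bounded_integrable => //.
- by rewrite /= lebesgue_measure_itv/=; case: ifPn => // _; rewrite -EFinB ltry.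
- exact: measurable_funS mz.
- exists M; split; first exact: num_real.
  by move=> N MN t _; exact: le_trans (zM t) (ltW MN).
Qed.

Lemma measurable_norm_powR q z : measurable_fun [set: R] z ->
  measurable_fun [set: R] (fun t => (`|z t| `^ q)%:E).
Proof.
move=> mz; apply/measurable_EFinP/(measurableT_comp (measurable_powR q)).
exact: measurableT_comp.
Qed.

Lemma Lq_loc_locally_integrable q z : 1 <= q -> Lq_loc q z ->
  locally_integrable setT z.
Proof.
move=> q1 [mz zq]; apply: integrable_itv_locally => // a b.
have i1 : mu.-integrable `[a, b] (EFin \o (fun=> 1)).
  apply/locally_integrable_itv/(@bounded_locally_integrable _ 1) => //.
  by move=> t; rewrite normr1.
have iq : mu.-integrable `[a, b] (fun t => (`|z t| `^ q)%:E).
  apply/integrableP; split.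
    exact: measurable_funTS (measurable_norm_powR q mz).
  under eq_integral do rewrite gee0_abs ?lee_fin ?powR_ge0//.
  exact: zq.
apply: le_integrable (integrableD _ i1 iq) => //.
  by apply/measurable_EFinP; exact: measurable_funS mz.
move=> x _; rewrite /= lee_fin [leRHS]ger0_norm ?addr_ge0 ?powR_ge0//.
have [z1|z1] := leP 1 `|z x|.
  by apply: (le_trans (le1r_powR z1 q1)); rewrite lerDr.
by apply: (le_trans (ltW z1)); rewrite lerDl powR_ge0.
Qed.

Lemma Lq_fun_loc q z : Lq_fun q z -> Lq_loc q z.
Proof.
move=> [mz zq]; split=> // a b; apply: le_lt_trans zq.
by apply: ge0_subset_integral => //; exact: measurable_norm_powR.
Qed.

Lemma Lq_loc_shift q z c : Lq_loc q z -> Lq_loc q (fun t => z (c + t)).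
Proof.
move=> [mz zq]; have pc := measure_preserving_shift c.
split; first exact: (measurableT_comp mz pc.1).
move=> a b; have := zq (c + a) (c + b).
rewrite -(ge0_integral_preserving pc)//; last first.
  by apply: measurable_funTS; exact: measurable_norm_powR.
congr (integral _ _ _ < _)%E; apply/seteqP.
by split=> x /=; rewrite !in_itv/= !lerD2l.
Qed.

Lemma integral_norm_le D z f a K M : locint_carried D z -> D a -> lbound D a ->
  measurable_fun [set: R] f -> vanish_gt K f ->
  (forall t, D t -> `|f t| <= M) ->
  (\int[mu]_t `|z t * f t|%:E <=
   (Rintegral mu `[a, K] (fun t => `|z t|) * M)%:E)%E.
Proof.
move=> [lz zD] Da aD mf fK fM; have mz : measurable_fun [set: R] z by case: lz.
have M0 : 0 <= M by exact: le_trans (fM a Da).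
have iz : mu.-integrable `[a, K] (EFin \o (fun t => `|z t|)).
  have := integrable_abse (locally_integrable_itv a K lz).
  by apply: eq_integrable.
have izM : mu.-integrable `[a, K] (fun t => (`|z t| * M)%:E).
  have iM mD := integrableZr mD M iz.
  by apply: eq_integrable (iM _).
rewrite -RintegralZr// /Rintegral fineK; last exact: integrable_fin_num.
rewrite [leRHS]integral_mkcond; apply: ae_ge0_le_integral => //.
- by apply/measurable_EFinP/measurableT_comp => //; exact: measurable_funM.
- by move=> t _; rewrite patchE; case: ifPn => // _; rewrite lee_fin mulr_ge0.
- by apply/(measurable_restrictT _ _).1 => //; have /integrableP[] := izM.
apply: filterS zD => t zt _; have [Dt|/zt ->] := pselect (D t); last first.
  by rewrite mul0r normr0 patchE; case: ifPn => // _; rewrite lee_fin mulr_ge0.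
rewrite patchE; case: ifPn => [_|];
  first by rewrite lee_fin normrM ler_wpM2l// fM.
rewrite notin_setE/= in_itv/= aD//= => /negP; rewrite -ltNge => Kt.
by rewrite fK// mulr0 normr0.
Qed.

Lemma integrable_locint_mul D z f a : locint_carried D z -> D a -> lbound D a ->
  measurable_fun [set: R] f -> (exists K, vanish_gt K f) ->
  (exists M, forall t, D t -> `|f t| <= M) ->
  mu.-integrable setT (EFin \o (fun t => z t * f t)).
Proof.
move=> cz Da aD mf [K fK] [M fM]; apply/integrableP; split.
  by apply/measurable_EFinP; apply: measurable_funM => //; case: cz => -[].
by apply: (le_lt_trans (integral_norm_le cz Da aD mf fK fM)); rewrite ltry.
Qed.

Definition rtest_integrable z :=
  forall f, rtest_fun f -> mu.-integrable setT (EFin \o (fun t => z t * f t)).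

Lemma locint_rtest_integrable D z a : locint_carried D z -> D a -> lbound D a ->
  rtest_integrable z.
Proof.
move=> cz Da aD f rf; apply: (integrable_locint_mul cz Da aD).
- exact: smooth_measurable rf.1.
- exact: rf.2.
- by have [M fM] := rtest_fun_bounded a rf; exists M => t /aD; exact: fM.
Qed.

Lemma fdistrZ c z f : rtest_integrable z -> rtest_fun f ->
  fdistr (fun t => c * z t) f = c * fdistr z f.
Proof.
move=> iz rf; rewrite /fdistr -RintegralZl//; last exact: iz.
by apply: eq_Rintegral => t _; rewrite mulrA.
Qed.

Lemma rtest_integrableZ c z :
  rtest_integrable z -> rtest_integrable (fun t => c * z t).
Proof.
move=> iz f rf; have := integrableZl measurableT c (iz f rf).
by apply: eq_integrable => // t _; rewrite /= -EFinM mulrA.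
Qed.

Lemma fdistrD z w f : rtest_integrable z -> rtest_integrable w -> rtest_fun f ->
  fdistr (fun t => z t + w t) f = fdistr z f + fdistr w f.
Proof.
move=> iz iw rf; rewrite /fdistr -RintegralD//; [|exact: iz|exact: iw].
by apply: eq_Rintegral => t _; rewrite mulrDl.
Qed.

Lemma rtest_integrableD z w : rtest_integrable z -> rtest_integrable w ->
  rtest_integrable (fun t => z t + w t).
Proof.
move=> iz iw f rf; have := integrableD measurableT (iz f rf) (iw f rf).
by apply: eq_integrable => // t _; rewrite /= -EFinD mulrDl.
Qed.

Lemma fdistr0 f : fdistr (fun=> 0) f = 0.
Proof.
rewrite /fdistr -[RHS](mul0r (fine (mu setT)))
  -(@Rintegral_cst _ _ _ mu setT)//.
by apply: eq_Rintegral => t _; rewrite mul0r.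
Qed.

Lemma rtest_integrable_sum (I : Type) (r : seq I) (z : I -> R -> R) :
  (forall i, rtest_integrable (z i)) ->
  rtest_integrable (fun t => \sum_(i <- r) z i t).
Proof.
move=> iz; elim: r => [|i r IHr].
  move=> f rf; have := @integrable0 _ _ _ mu setT.
  by apply: eq_integrable => // t _; rewrite /= big_nil mul0r.
have := rtest_integrableD (iz i) IHr; congr rtest_integrable.
by apply/funext => t; rewrite big_cons.
Qed.

Lemma fdistr_sum (I : Type) (r : seq I) (z : I -> R -> R) f :
  (forall i, rtest_integrable (z i)) -> rtest_fun f ->
  fdistr (fun t => \sum_(i <- r) z i t) f = \sum_(i <- r) fdistr (z i) f.
Proof.
move=> iz rf; elim: r => [|i r IHr].
  rewrite big_nil -[RHS](fdistr0 f); congr fdistr.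
  by apply/funext => t; rewrite big_nil.
rewrite big_cons -IHr -fdistrD//; last exact: rtest_integrable_sum.
by congr fdistr; apply/funext => t; rewrite big_cons.
Qed.

Lemma rtest_integrable_shift c z :
  rtest_integrable z -> rtest_integrable (fun t => z (- c + t)).
Proof.
move=> iz f rf; have := iz _ (rtest_fun_shift c rf).
move/(integrable_preserving (measure_preserving_shift (- c))).
by apply: eq_integrable => // t _; rewrite /= addNKr.
Qed.

Lemma fdistr_shift z c f : rtest_integrable z -> rtest_fun f ->
  fdistr (fun t => z (- c + t)) f = fdistr z (fun t => f (c + t)).
Proof.
move=> iz rf; rewrite [RHS]/fdistr.
rewrite -(Rintegral_preserving (measure_preserving_shift (- c)))/=; last first.
  exact: iz (rtest_fun_shift c rf).
by apply: eq_Rintegral => t _; rewrite addNKr.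
Qed.

Lemma fdistr_ae_eq z w f : rtest_integrable z -> rtest_integrable w ->
  rtest_fun f -> {ae mu, forall t, z t = w t} -> fdistr z f = fdistr w f.
Proof.
move=> iz iw rf zw; apply: ae_eq_Rintegral => //.
- by have /integrableP[/measurable_EFinP] := iz f rf.
- by have /integrableP[/measurable_EFinP] := iw f rf.
- by apply: filterS zw => t ->.
Qed.

Lemma is_radon_fdistr D z a : locint_carried D z -> D a -> lbound D a ->
  is_radon D (fdistr z).
Proof.
move=> cz Da aD; have iz := locint_rtest_integrable cz Da aD.
split=> [c f g rf rg|K].
  rewrite /fdistr -RintegralZl//; last exact: iz.
  rewrite -RintegralD//; last exact: iz.
    by apply: eq_Rintegral => t _; ring.
  have := integrableZl measurableT c (iz f rf).
  by apply: eq_integrable.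
exists (Rintegral mu `[a, K] (fun t => `|z t|)) => f M rf fK fM.
have mf := smooth_measurable rf.1.
rewrite -lee_fin; apply: le_trans (integral_norm_le cz Da aD mf fK fM).
rewrite EFin_normr_Rintegral//; last exact: iz.
by apply: le_abse_integral => //; have /integrableP[] := iz f rf.
Qed.

Lemma causal_rtest_integrable a z : causal a z -> rtest_integrable z.
Proof. by move=> cz; apply: (locint_rtest_integrable cz (a := a)) => /=. Qed.

Lemma is_radon_causal a z : causal a z -> is_radon_ge a (fdistr z).
Proof. by move=> cz; apply: (is_radon_fdistr cz (a := a)) => /=. Qed.

Lemma exp_dominated_mul_le g f G lam M t : 0 < lam -> `|g t| <= G ->
  (t < 0 -> g t = 0) -> exp_dominated lam M f ->
  `|g t * f t| <= G / lam * M * exponential_pdf lam t.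
Proof.
move=> lam0 gG g0 fM; have [t0|t0] := ltP t 0.
  by rewrite lt0_exponential_pdf// g0// mul0r normr0 mulr0.
rewrite exponential_pdfE//.
have -> : G / lam * M * (lam * expR (- lam * t)) = G * (M * expR (- (lam * t))).
  by rewrite mulNr; field; rewrite gt_eqF.
by rewrite normrM ler_pM// fM.
Qed.

Lemma exp_bounded_fdistr (g : R -> R) G lam : 0 < lam ->
  measurable_fun [set: R] g -> (forall s, `|g s| <= G) ->
  (forall s, s < 0 -> g s = 0) -> exp_bounded lam (G / lam) (fdistr g).
Proof.
move=> lam0 mg gG g0 f M rf fM.
have cg : causal 0 g.
  split; first exact: bounded_locally_integrable gG.
  by apply: aeW => t /= /negP; rewrite -ltNge; exact: g0.
have igf : mu.-integrable setT (EFin \o (fun t => g t * f t)).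
  exact: causal_rtest_integrable cg f rf.
have ipdf := integrable_exponential_pdf lam0.
have cpdf := integrableZl measurableT (G / lam * M) ipdf.
rewrite (le_trans (le_normr_Rintegral _ _))//.
have -> : G / lam * M =
    Rintegral mu setT (fun t => G / lam * M * exponential_pdf lam t).
  by rewrite RintegralZl// /Rintegral integral_exponential_pdf// mulr1.
apply: le_Rintegral => //.
- by have := integrable_abse igf; apply: eq_integrable.
- by move=> t _; apply: exp_dominated_mul_le => //; exact: g0.
Qed.

Lemma exp_negligible_fdistr (g : R -> R) G : measurable_fun [set: R] g ->
  (forall s, `|g s| <= G) -> (forall s, s < 0 -> g s = 0) ->
  exp_negligible (fdistr g).
Proof.
move=> mg gG g0 e e0; near=> lam.
have lam0 : 0 < lam by near: lam; exact/nbhs_pinfty_gt/num_real.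
have lam_ge : G / e <= lam by near: lam; exact/nbhs_pinfty_ge/num_real.
apply: exp_boundedW (exp_bounded_fdistr lam0 mg gG g0).
by rewrite ler_pdivrMr// mulrC -ler_pdivrMr.
Unshelve. all: by end_near. Qed.

End locally_integrable_functions.

Section convolution_of_functions.
Variable R : realType.
Local Notation mu := (@lebesgue_measure R).

Definition fun_conv (g x : R -> R) t :=
  Rintegral mu setT (fun s => g s * x (t - s)).

Variables (g x : R -> R) (G a : R).
Hypothesis g_integrable : mu.-integrable setT (EFin \o g).
Hypothesis g_bounded : forall s, `|g s| <= G.
Hypothesis g_lt0 : forall s, s < 0 -> g s = 0.
Hypothesis x_causal : causal a x.

Let g_measurable : measurable_fun [set: R] g.
Proof. by have /integrableP[/measurable_EFinP] := g_integrable. Qed.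

Let x_measurable : measurable_fun [set: R] x.
Proof. by case: x_causal => -[]. Qed.

Lemma measurable_translate t : measurable_fun [set: R] (fun s => x (s - t)).
Proof. by apply: (measurableT_comp x_measurable); exact: measurable_funB. Qed.

Lemma integrable_kernel_section t :
  mu.-integrable setT (EFin \o (fun s => g s * x (t - s))).
Proof.
have refl := measure_preserving_reflect t.
have xg : mu.-integrable setT (EFin \o (fun s => x s * g (t - s))).
  apply: (integrable_locint_mul x_causal (a := a)) => //=.
  - exact: measurableT_comp g_measurable refl.1.
  - by exists t => s ts; apply: g_lt0; rewrite subr_lt0.
  - by exists G.
have := integrable_preserving refl xg; apply: eq_integrable => // s _.
by rewrite /= subKr mulrC.
Qed.

Lemma kernel_section_le K M f s : measurable_fun [set: R] f ->
  vanish_gt K f -> (forall t, a <= t -> `|f t| <= M) ->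
  (\int[mu]_t `|g s * x (t - s) * f t|%:E <=
   (`|g s| * (Rintegral mu `[a, K] (fun t => `|x t|) * M))%:E)%E.
Proof.
move=> mf fK fM; have [s0|s0] := ltP s 0.
  by rewrite g_lt0// normr0 mul0r integral0_eq// => t _; rewrite !mul0r normr0.
have mfs : measurable_fun [set: R] (fun t => f (s + t)).
  exact: (measurableT_comp mf (measure_preserving_shift s).1).
have mF : measurable_fun [set: R] (fun t => `|g s * x (t - s) * f t|%:E).
  apply/measurable_EFinP/measurableT_comp => //; apply: measurable_funM => //.
  by apply: measurable_funM => //; exact: measurable_translate.
rewrite -(integral_preserving (measure_preserving_shift s) mF).
under eq_integral do rewrite addrC addKr -mulrA normrM EFinM.
rewrite ge0_integralZl_EFin//.
  rewrite EFinM lee_wpmul2l//.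
  apply: (integral_norm_le x_causal _ _ mfs) => //= t.
    by move=> Kt; apply: fK; rewrite (lt_le_trans Kt)// lerDr.
  by move=> a_le; apply: fM; rewrite (le_trans a_le)// lerDr.
by apply/measurable_EFinP/measurableT_comp => //; exact: measurable_funM.
Qed.

Lemma measurable_kernel f : measurable_fun [set: R] f ->
  measurable_fun setT (fun p : R * R => (g p.2 * x (p.1 - p.2) * f p.1)%:E).
Proof.
move=> mf; apply/measurable_EFinP.
apply: measurable_funM; last exact: measurableT_comp.
apply: measurable_funM; first exact: measurableT_comp.
by apply: (measurableT_comp x_measurable); exact: measurable_funB.
Qed.

Lemma integrable_kernel f : rtest_fun f ->
  (mu \x mu)%E.-integrable setT (fun p => (g p.2 * x (p.1 - p.2) * f p.1)%:E).
Proof.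
move=> rf; have [sf [K fK]] := rf; have [M fM] := rtest_fun_bounded a rf.
have mk := measurable_kernel (smooth_measurable sf).
apply/integrable21ltyP => //.
pose C := Rintegral mu `[a, K] (fun t => `|x t|) * M.
have C0 : 0 <= C.
  rewrite mulr_ge0 ?(le_trans _ (fM a _))//.
  by apply: Rintegral_ge0 => t _.
have iC : mu.-integrable setT (fun s => (`|g s| * C)%:E).
  have := integrableZr measurableT C (integrable_abse g_integrable).
  by apply: eq_integrable.
apply: (@le_lt_trans _ _ (\int[mu]_s (`|g s| * C)%:E)%E); last first.
  by rewrite ltey_eq integrable_fin_num.
apply: ge0_le_integral => //.
- by move=> s _; apply: integral_ge0.
- have mabs := measurableT_comp (@abse_measurable R setT) mk.
  exact: (@measurable_fun_fubini_tonelli_G _ _ (measurableTypeR R)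
    (measurableTypeR R) R mu _ mabs (fun p => abse_ge0 _)).
- by have /integrableP[] := iC.
- by move=> s _; exact: kernel_section_le (smooth_measurable sf) fK fM.
Qed.

Lemma integral_kernel_fst t f :
  (\int[mu]_s (g s * x (t - s) * f t)%:E = (fun_conv g x t * f t)%:E)%E.
Proof.
have iz : mu.-integrable setT (EFin \o (fun s => g s * x (t - s) * f t)).
  have := integrableZr measurableT (f t) (integrable_kernel_section t).
  by apply: eq_integrable.
rewrite -[LHS]fineK; last exact: integrable_fin_num.
congr EFin; rewrite -/(Rintegral mu setT _) RintegralZr//.
exact: integrable_kernel_section.
Qed.

Lemma integral_kernel_snd s f : rtest_fun f ->
  (\int[mu]_t (g s * x (t - s) * f t)%:E =
   (g s * fdistr x (fun t => f (s + t)))%:E)%E.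
Proof.
move=> rf; have ix := causal_rtest_integrable x_causal (rtest_fun_shift s rf).
have ms : measurable_fun [set: R] (fun t => (g s * x (t - s) * f t)%:E).
  apply/measurable_EFinP/measurable_funM; last exact: smooth_measurable rf.1.
  by apply: measurable_funM => //; exact: measurable_translate.
rewrite -(integral_preserving (measure_preserving_shift s) ms).
rewrite /fdistr -RintegralZl// /Rintegral fineK.
  by apply: eq_integral => t _; rewrite (addrC s t) addrK mulrA.
apply: integrable_fin_num => //.
have := integrableZl measurableT (g s) ix.
by apply: eq_integrable.
Qed.

Lemma rtest_integrable_fun_conv : rtest_integrable (fun_conv g x).
Proof.
move=> f rf; have := integrable_fubini_F (integrable_kernel rf).
by apply: eq_integrable => // t _; exact: integral_kernel_fst.
Qed.

Lemma rconv_fdistr f : rtest_fun f ->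
  rconv (fdistr g) (fdistr x) f = fdistr (fun_conv g x) f.
Proof.
move=> rf; congr fine.
under [RHS]eq_integral do rewrite -integral_kernel_fst.
rewrite (Fubini (integrable_kernel rf)).
by apply: eq_integral => s _; rewrite integral_kernel_snd.
Qed.

End convolution_of_functions.

(** * The delay system *)

Definition causal_cV (R : realType) n a (x : R -> 'cV[R]_n) :=
  forall i, causal a (fun t => x t i 0).

Section essential_support.
Variable R : realType.
Local Notation mu := (@lebesgue_measure R).
Implicit Types (A B : set R).

(* R being second countable, countably many of the intervals suffice. *)
Lemma negligible_locally A B :
  (forall t, A t -> exists2 e : R, 0 < e &
    mu.-negligible (`]t - e, t + e[ `&` B)) ->
  mu.-negligible (A `&` B).
Proof.
move=> locB; pose Z (p : rat * rat) := `]ratr p.1, ratr p.2[%classic `&` B.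
pose F n := if unpickle n is Some p then
  (if `[< mu.-negligible (Z p) >] then Z p else set0) else set0.
have nF : mu.-negligible (\bigcup_n F n).
  apply: negligible_bigcup => n; rewrite /F; case: unpickle => [p|].
    by case: asboolP => // _; exact: negligible_set0.
  exact: negligible_set0.
apply: negligibleS nF => t [/locB[e e0 nB] Bt].
have te : t - e < t by rewrite ltrBlDr ltrDl.
have et : t < t + e by rewrite ltrDl.
have [q1] := rat_in_itvoo te; rewrite in_itv/= => /andP[eq1 q1t].
have [q2] := rat_in_itvoo et; rewrite in_itv/= => /andP[tq2 q2e].
have nZ : mu.-negligible (Z (q1, q2)).
  apply: negligibleS nB => s [/=]; rewrite !in_itv/= => /andP[q1s sq2] Bs.
  by split=> //; rewrite (lt_trans eq1)//= (lt_trans sq2).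
exists (pickle (q1, q2)); first exact: I.
by rewrite /F pickleK asboolT//; split=> //=; rewrite in_itv/= q1t.
Qed.

Lemma measurable_cV_neq0 m (u : R -> 'cV[R]_m) :
  (forall i, measurable_fun [set: R] (fun t => u t i 0)) ->
  measurable [set t | u t != 0].
Proof.
move=> u_meas.
have -> : [set t | u t != 0] =
    \bigcup_(i in [set: 'I_m]) ((fun t => u t i 0) @^-1` [set~ 0]).
  apply/seteqP; split=> t /=.
  - move=> /matrix0Pn[i [j uij]]; exists i => //=.
    by apply/eqP; rewrite (ord1 j) in uij.
  - by move=> [i _ /= /eqP ui]; apply/matrix0Pn; exists i, 0.
apply: fin_bigcup_measurable; first exact: finite_finset.
move=> i _; rewrite -[_ @^-1` _]setTI.
by apply: u_meas => //; exact: measurableC.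
Qed.

Lemma ae_eq0_off_ess_supp m (u : R -> 'cV[R]_m) :
  (forall i, measurable_fun [set: R] (fun t => u t i 0)) ->
  {ae mu, forall t, ~ ess_supp u t -> u t = 0}.
Proof.
move=> u_meas; have u_neq0_meas := measurable_cV_neq0 u_meas.
suff : mu.-negligible (~` ess_supp u `&` [set t | u t != 0]).
  by apply: negligibleS => t /= /not_implyP[nt /eqP].
apply: negligible_locally => t /= /existsNP[e /not_implyP[e0 /negP]].
rewrite lt0e measure_ge0 andbT negbK => /eqP nz0; exists e => //.
have nzE : nz_near u t e = `]t - e, t + e[%classic `&` [set t | u t != 0].
  by apply/seteqP; split=> s; rewrite /nz_near /= in_itv/=.
by rewrite -nzE; apply/negligibleP => //; rewrite nzE; exact: measurableI.
Qed.

Lemma after_suppW m (u : R -> 'cV[R]_m) s t :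
  s <= t -> after_supp u s -> after_supp u t.
Proof. by move=> st [r [ru rs]]; exists r; split=> //; exact: le_trans st. Qed.

Lemma Omega_causal q m (u : R -> 'cV[R]_m) : 1 <= q -> Omega q u ->
  exists2 a, (forall t, after_supp u t -> a <= t) & causal_cV a u.
Proof.
move=> q1 [uq [a [_ ua]]]; exists a => [t [s [/ua us st]]|k].
  by move: us; rewrite /= in_itv/= => /andP[us _]; exact: le_trans st.
split; first exact: Lq_loc_locally_integrable q1 (Lq_fun_loc (uq k)).
apply: filterS (ae_eq0_off_ess_supp (fun i => (uq i).1)) => t ut ta.
by rewrite ut ?mxE// => /ua; rewrite /= in_itv/= => /andP[/ta].
Qed.

End essential_support.

Definition bounded_density (R : realType) d L G (h : R -> 'M[R]_(d, d)) :=
  [/\ forall i j, measurable_fun [set: R] (fun s => h s i j),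
      forall i j s, `|h s i j| <= G
    & forall i j s, ~~ (0 <= s <= L) -> h s i j = 0].

Section truncation.
Variable R : realType.
Implicit Types (g : R -> R) (L M s : R).

Definition truncate L M g s := Num.max (- M) (Num.min M ((g \_ `[0, L]) s)).

Lemma measurable_truncate L M g : measurable_fun `[0, L] g ->
  measurable_fun [set: R] (truncate L M g).
Proof.
move=> mg; apply: measurable_maxr => //; apply: measurable_minr => //.
exact/(measurable_restrictT g (measurable_itv `[0, L])).
Qed.

Lemma truncate_norm_le L M g s : 0 <= M -> `|truncate L M g s| <= M.
Proof.
move=> M0; rewrite ler_norml le_max lexx/= ge_max ge_min lexx/= andbT.
by rewrite (@le_trans _ _ 0)// oppr_le0.
Qed.

Lemma truncate_eq0 L M g s : 0 <= M -> ~~ (0 <= s <= L) -> truncate L M g s = 0.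
Proof.
move=> M0 nsL; rewrite /truncate patchE ifF; last first.
  by apply: negbTE; rewrite notin_setE/= in_itv/=; exact/negP.
by rewrite (min_idPr M0) (max_idPr _)// oppr_le0.
Qed.

Lemma truncate_id L M g s : 0 <= s <= L -> `|g s| <= M ->
  truncate L M g s = g s.
Proof.
move=> sL; rewrite ler_norml => /andP[gM Mg].
rewrite /truncate patchE ifT; last by rewrite inE/= in_itv/=.
by rewrite (min_idPr Mg) (max_idPr gM).
Qed.

Lemma bounded_representative d L M (g : R -> 'M[R]_(d, d)) :
  (forall i j, measurable_fun `[0, L] (fun s => g s i j)) ->
  {ae (@lebesgue_measure R), forall s, s \in `[0, L] ->
    forall i j, `|g s i j| <= M} ->
  exists2 h : R -> 'M[R]_(d, d), bounded_density L `|M| h &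
    forall i j, {ae (@lebesgue_measure R),
      forall s, `[0, L]%classic s -> g s i j = h s i j}.
Proof.
move=> mg gM; pose t i j := truncate L `|M| (fun s => g s i j).
exists (fun s => \matrix_(i, j) t i j s); last first.
  move=> i j; apply: filterS gM => s gs sL; rewrite mxE [RHS]truncate_id//.
  exact: le_trans (gs sL i j) (ler_norm M).
split=> [i j|i j s|i j s sL].
- rewrite (_ : (fun s => _) = t i j); first exact: measurable_truncate.
  by apply/funext => s; rewrite mxE.
- by rewrite mxE truncate_norm_le.
- by rewrite mxE [LHS]truncate_eq0.
Qed.

End truncation.

Section convolution_systems.
Variables (R : realType) (d m : nat) (k : dmx R d d) (B : 'M[R]_(d, m)) (L : R).
Local Notation delta := (@dmx_deltaI R d).

Definition fdistr_col n (x : R -> 'cV[R]_n) : dmx R n 1 :=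
  fun i _ => fdistr (fun t => x t i 0).

Definition convolution_io q (u : R -> 'cV[R]_m) (y : R -> 'cV[R]_d) :=
  exists a (x : R -> 'cV[R]_d),
    [/\ forall i, Lq_loc q (fun t => x t i 0),
        causal_cV a x, causal_cV a u,
        dmx_rdeq (fdistr_col x)
          (dmx_add (dmx_rconv k (fdistr_col x))
                   (dmx_rconv (dmx_point_mass B) (fdistr_col u)))
      & forall t, 0 <= t -> y t = x (t - L)].

Definition advanced_den : dmx R d d := dmx_shift (- L) (dmx_sub delta k).

Definition delayed_inverse : dmx R d d := dmx_shift L (neumann k).

Lemma radon_mx_fdistr_col n a (x : R -> 'cV[R]_n) :
  causal_cV a x -> radon_mx_ge a (fdistr_col x).
Proof. by move=> cx i j; exact: is_radon_causal. Qed.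

Hypotheses (L_ge0 : 0 <= L) (k_radon : radon_mx `[0, L] k).
Hypothesis k_negligible : forall i j, exp_negligible (k i j).

Let k_radon_ge0 : radon_mx_ge 0 k.
Proof.
by move=> i j; apply: is_radonS (k_radon i j) => x;
  rewrite /= in_itv/= => /andP[].
Qed.

Let delta_radon : radon_mx_ge 0 delta.
Proof. by apply: radon_mx_deltaI => /=. Qed.

Lemma radon_mx_advanced_den : radon_mx_ge (- L) advanced_den.
Proof.
apply: radon_mx_shift (radon_mx_sub delta_radon k_radon_ge0) => x /=.
by rewrite lerDl.
Qed.

Lemma radon_mx_delayed_inverse : radon_mx_ge L delayed_inverse.
Proof.
apply: radon_mx_shift (radon_mx_neumann k_radon_ge0 k_negligible) => x /=.
by rewrite lerDl.
Qed.

Lemma advanced_den_in_Eminus i j : in_Eminus (advanced_den i j).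
Proof.
apply: (@radon_in_Eminus _ (- L)); first by rewrite oppr_le0.
have delta0L : radon_mx `[0, L] delta.
  by apply: radon_mx_deltaI; rewrite /= in_itv/= lexx.
apply: radon_mx_shift (radon_mx_sub delta0L k_radon) i j => x.
by rewrite /= !in_itv/= lerDl addrC subr_le0.
Qed.

Lemma delayed_inverse_rconvl :
  dmx_rdeq (dmx_rconv delayed_inverse advanced_den) delta.
Proof.
move=> i j f rf.
by rewrite dmx_rconv_shift subrr dmx_shift0 (neumannr k_radon_ge0).
Qed.

Lemma delayed_inverse_rconvr :
  dmx_rdeq (dmx_rconv advanced_den delayed_inverse) delta.
Proof.
move=> i j f rf.
by rewrite dmx_rconv_shift addNr dmx_shift0 (neumannl k_radon_ge0).
Qed.

Lemma convolution_equation_solution a (X : dmx R d 1) (V : dmx R d 1) :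
  radon_mx_ge a X -> dmx_rdeq X (dmx_add (dmx_rconv k X) V) ->
  dmx_rdeq (dmx_rconv delayed_inverse V) (dmx_shift L X).
Proof.
move=> mX XV i j f rf.
have mZ : radon_mx_ge (L + a) (dmx_shift L X).
  by apply: radon_mx_shift mX => x /=; rewrite lerD2l.
have VE : dmx_rdeq V (dmx_rconv advanced_den (dmx_shift L X)).
  move=> {rf} i' j' h rh; rewrite dmx_rconv_shift addNr dmx_shift0 dmx_rconvBl.
  by rewrite dmx_subE dmx_rconv_deltal// XV// dmx_addE addrC addKr.
rewrite (dmx_rconv_rdeqr delayed_inverse VE)//.
rewrite -(dmx_rconvA radon_mx_delayed_inverse radon_mx_advanced_den mZ)//.
by rewrite (dmx_rconv_rdeql mZ delayed_inverse_rconvl)// dmx_rconv_deltal.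
Qed.

Lemma dmx_shift_fdistr_col a (x : R -> 'cV[R]_d) :
  causal_cV a x ->
  dmx_rdeq (dmx_shift L (fdistr_col x)) (fdistr_col (fun t => x (- L + t))).
Proof.
by move=> cx i j f rf; apply/esym/fdistr_shift;
  [exact: causal_rtest_integrable|].
Qed.

Lemma pseudo_rational0_convolution q
    (io : (R -> 'cV[R]_m) -> (R -> 'cV[R]_d) -> Prop) :
  (forall u y, Omega q u -> io u y -> convolution_io q u y) ->
  pseudo_rational0 q io.
Proof.
move=> io_conv.
have mQ := radon_mx_advanced_den; have mQinv := radon_mx_delayed_inverse.
exists advanced_den, (dmx_point_mass B), delayed_inverse.
split; first exact: advanced_den_in_Eminus.
split.
  move=> i j; apply: (@radon_in_Eminus _ 0) => //; apply: radon_mx_point_mass.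
  by rewrite /= in_itv/= lexx.
split; first by move=> i j; exact: radon_in_Dplus (mQinv i j).
split.
  move=> i j phi tphi; rewrite (dmx_conv_rconv mQinv mQ)//.
  exact: dmx_rdeq_eq delayed_inverse_rconvl _ _ _ tphi.
split.
  move=> i j phi tphi; rewrite (dmx_conv_rconv mQ mQinv)//.
  exact: dmx_rdeq_eq delayed_inverse_rconvr _ _ _ tphi.
split.
  by apply: dmx_det_order_zero => i j; exists L, (delayed_inverse i j).
move=> u y Ou /(io_conv u y Ou)[a [x [xq cx cu Xeq yx]]].
exists (fun t => x (- L + t)); split.
  by move=> i; exact: (Lq_loc_shift (- L) (xq i)).
split; last by apply: aeW => t t0; rewrite yx// addrC.
have mP : radon_mx_ge 0 (dmx_point_mass B) by apply: radon_mx_point_mass => /=.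
have mU := radon_mx_fdistr_col cu.
move=> i j phi tphi; have rphi := test_fun_rtest tphi.
rewrite (dmx_conv_rconv mQinv (radon_mx_conv mP mU) _
  (dmx_conv_rconv mP mU _ _))//.
rewrite (convolution_equation_solution (radon_mx_fdistr_col cx) Xeq)//.
exact: dmx_shift_fdistr_col cx _ _ _ rphi.
Qed.

End convolution_systems.

Section delay_kernel.
Variables (R : realType) (d m N : nat) (Lam : nat -> R).
Variables (A : nat -> 'M[R]_(d, d)) (B : 'M[R]_(d, m)).
Variables (h : R -> 'M[R]_(d, d)) (G : R).
Local Notation mu := (@lebesgue_measure R).
Local Notation L := (Lam N).

Definition delay_kernel : dmx R d d := fun i j =>
  dadd (\big[@dadd R/@dzero R]_(l < N)
          dscale (A l.+1 i j) (point_mass (Lam l.+1)))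
       (fdistr (fun s => h s i j)).

Hypothesis L_ge0 : 0 <= L.
Hypothesis delays : forall l : 'I_N, 0 < Lam l.+1 <= L.
Hypothesis h_density : bounded_density L G h.

Let h_measurable i j : measurable_fun [set: R] (fun s => h s i j).
Proof. by case: h_density. Qed.

Let h_bounded i j s : `|h s i j| <= G. Proof. by case: h_density. Qed.

Let h_out i j s : ~~ (0 <= s <= L) -> h s i j = 0.
Proof. by case: h_density => _ _; apply. Qed.

Let h_lt0 i j s : s < 0 -> h s i j = 0.
Proof. by move=> s0; apply: h_out; rewrite leNgt s0. Qed.

Let h_locint i j : locally_integrable setT (fun s => h s i j).
Proof.
exact: bounded_locally_integrable (h_measurable i j) (h_bounded i j).
Qed.

Lemma radon_mx_delay_kernel : radon_mx `[0, L] delay_kernel.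
Proof.
move=> i j; apply: is_radonD.
  apply: is_radon_sum => l _; apply/is_radonZ/is_radon_point_mass.
  by have /andP[Ll0 LlL] := delays l; rewrite /= in_itv/= ltW.
apply: (is_radon_fdistr (a := 0)).
- split=> //; apply: aeW => s; rewrite /= in_itv/= => /negP; exact: h_out.
- by rewrite /= in_itv/= lexx.
- by move=> s; rewrite /= in_itv/= => /andP[].
Qed.

Lemma delay_kernel_negligible i j : exp_negligible (delay_kernel i j).
Proof.
apply: exp_negligibleD.
  apply: exp_negligible_sum => l _.
  apply/exp_negligibleZ/exp_negligible_point_mass.
  by have /andP[] := delays l.
exact: exp_negligible_fdistr (h_measurable i j) (h_bounded i j) (@h_lt0 i j).
Qed.

Lemma integrable_delay_density i j :
  mu.-integrable setT (EFin \o (fun s => h s i j)).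
Proof.
have := locally_integrable_itv 0 L (h_locint i j).
move/integrable_mkcond => /(_ (measurable_itv `[0, L])).
apply: eq_integrable => // s _; rewrite patchE; case: ifPn => //.
by rewrite notin_setE/= in_itv/= => /negP /h_out ->.
Qed.

Lemma rtest_integrable_density_conv a i k z :
  causal a z -> rtest_integrable (fun_conv (fun s => h s i k) z).
Proof.
exact: rtest_integrable_fun_conv (integrable_delay_density i k) (h_bounded i k)
  (@h_lt0 i k).
Qed.

Definition delay_response i k (z : R -> R) t : R :=
  \sum_(l < N) A l.+1 i k * z (- Lam l.+1 + t)
  + fun_conv (fun s => h s i k) z t.

Lemma rtest_integrable_delay_response a i k z :
  causal a z -> rtest_integrable (delay_response i k z).
Proof.
move=> cz; apply: rtest_integrableD.
  apply: rtest_integrable_sum => l; apply: rtest_integrableZ.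
  exact/rtest_integrable_shift/(causal_rtest_integrable cz).
exact: rtest_integrable_density_conv cz.
Qed.

Lemma rconv_delay_kernel a i k z f : causal a z -> rtest_fun f ->
  rconv (delay_kernel i k) (fdistr z) f = fdistr (delay_response i k z) f.
Proof.
move=> cz rf; have iz := causal_rtest_integrable cz.
have iA (l : 'I_N) :
    rtest_integrable (fun t => A l.+1 i k * z (- Lam l.+1 + t)).
  exact/rtest_integrableZ/rtest_integrable_shift.
rewrite fdistrD//; last 2 first.
- exact: rtest_integrable_sum.
- exact: rtest_integrable_density_conv cz.
rewrite -(rconv_fdistr (integrable_delay_density i k) (h_bounded i k)
  (@h_lt0 i k) cz)//.
rewrite fdistr_sum// /rconv /delay_kernel {1}/dadd big_daddE; congr (_ + _).
apply: eq_bigr => l _; rewrite fdistrZ;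
  [|exact: rtest_integrable_shift|exact: rf].
by rewrite fdistr_shift.
Qed.

Lemma fdistr_delay_equation a (u : R -> 'cV[R]_m) (x : R -> 'cV[R]_d) :
  causal_cV a u -> causal_cV a x ->
  {ae mu, forall t i, x t i 0 =
    \sum_k delay_response i k (fun s => x s k 0) t + \sum_k B i k * u t k 0} ->
  dmx_rdeq (fdistr_col x)
    (dmx_add (dmx_rconv delay_kernel (fdistr_col x))
             (dmx_rconv (dmx_point_mass B) (fdistr_col u))).
Proof.
move=> cu cx x_eq i j f rf.
have iu k := causal_rtest_integrable (cu k).
have iBu k : rtest_integrable (fun t => B i k * u t k 0).
  exact: rtest_integrableZ.
have iK k := rtest_integrable_delay_response i k (cx k).
have isK := rtest_integrable_sum (index_enum _) iK.
have isBu := rtest_integrable_sum (index_enum _) iBu.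
rewrite /fdistr_col dmx_addE !dmx_rconvE.
rewrite (fdistr_ae_eq (causal_rtest_integrable (cx i))
  (rtest_integrableD isK isBu))//;
  last by apply: filterS x_eq => t.
rewrite fdistrD// !fdistr_sum//; congr (_ + _); apply: eq_bigr => k _.
  by rewrite -(rconv_delay_kernel i k (cx k)).
rewrite fdistrZ// /dmx_point_mass /dscale /correlation; congr (_ * fdistr _ _).
by apply/funext => t; rewrite add0r.
Qed.

End delay_kernel.

Section delay_equation.
Variables (R : realType) (d m N : nat) (q : R) (Lam : nat -> R).
Variables (A : nat -> 'M[R]_(d, d)) (B : 'M[R]_(d, m)).
Local Notation mu := (@lebesgue_measure R).
Local Notation L := (Lam N).

Lemma DI_io_ae_eq (g h : R -> 'M[R]_(d, d)) u y :
  (forall i j, measurable_fun `[0, L] (fun s => g s i j)) ->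
  (forall i j, measurable_fun `[0, L] (fun s => h s i j)) ->
  (forall i j, {ae mu, forall s, `[0, L]%classic s -> g s i j = h s i j}) ->
  DI_io N q Lam A B g u y -> DI_io N q Lam A B h u y.
Proof.
move=> mg h_measurable gh [x [xq [x_eq x_rest]]].
exists x; split; [exact: xq|split=> //].
apply: filterS x_eq => t x_eq /x_eq ->.
congr (_ + _ + _); apply/matrixP => i j; rewrite !mxE.
apply: eq_bigr => k _.
have mxt : measurable_fun `[0, L] (fun s => x (t - s) k 0).
  apply: measurable_funTS.
  exact: (measurableT_comp (xq k).1 (measure_preserving_reflect t).1).
apply: ae_eq_Rintegral => //.
- exact: measurable_funM (mg i k) mxt.
- exact: measurable_funM (h_measurable i k) mxt.
- by apply: filterS (gh i k) => s ghs sL; rewrite ghs.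
Qed.

Variable h : R -> 'M[R]_(d, d).
Hypothesis delays : forall l : 'I_N, 0 < Lam l.+1 <= L.
Hypothesis h_measurable : forall i j,
  measurable_fun [set: R] (fun s => h s i j).
Hypothesis h_out : forall i j s, ~~ (0 <= s <= L) -> h s i j = 0.

Lemma fun_conv_itv i k z t : fun_conv (fun s => h s i k) z t =
  Rintegral mu `[0, L] (fun s => h s i k * z (t - s)).
Proof.
rewrite [RHS]Rintegral_mkcond; apply: eq_Rintegral => s _.
rewrite patchE; case: ifPn => //; rewrite notin_setE/= in_itv/= => /negP ns.
by rewrite h_out// mul0r.
Qed.

Variables (u : R -> 'cV[R]_m) (x : R -> 'cV[R]_d).
Hypothesis x_measurable : forall k, measurable_fun [set: R] (fun t => x t k 0).
Hypothesis x_before : {ae mu, forall t, ~ after_supp u t -> x t = 0}.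

Lemma fun_conv_before i k t : ~ after_supp u t ->
  fun_conv (fun s => h s i k) (fun s => x s k 0) t = 0.
Proof.
move=> nt; rewrite /fun_conv (@ae_eq_Rintegral _ _ _ _ _ _ (fun=> 0))//.
- by rewrite Rintegral_cst// mul0r.
- have mxt := measurableT_comp (x_measurable k)
    (measure_preserving_reflect t).1.
  exact: measurable_funM (h_measurable i k) mxt.
- have x_reflected := ae_preserving (measure_preserving_reflect t) x_before.
  apply: filterS x_reflected => s xs _.
  have [/andP[s0 _]|/h_out ->] := boolP (0 <= s <= L); last by rewrite mul0r.
  rewrite xs ?mxE ?mulr0// => ts; apply/nt/(after_suppW _ ts).
  by rewrite gerBl.
Qed.

Lemma state_equation : (forall k, measurable_fun [set: R] (fun t => u t k 0)) ->
  {ae mu, forall t, after_supp u t ->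
     x t = \sum_(1 <= j < N.+1) A j *m x (t - Lam j)
       + \col_i (\sum_k Rintegral mu `[0, L] (fun s => h s i k * x (t - s) k 0))
       + B *m u t} ->
  {ae mu, forall t i, x t i 0 =
    \sum_k delay_response N Lam A h i k (fun s => x s k 0) t
    + \sum_k B i k * u t k 0}.
Proof.
move=> u_meas x_eq; have u_before := ae_eq0_off_ess_supp u_meas.
have x_delayed : {ae mu, forall t (l : nat),
    ~ after_supp u (- Lam l.+1 + t) -> x (- Lam l.+1 + t) = 0}.
  apply: ae_foralln => l.
  exact: (ae_preserving (measure_preserving_shift (- Lam l.+1)) x_before).
apply: filterS2 (filterI x_eq x_before) (filterI x_delayed u_before).
move=> t [xt nxt] [dt ut] i.
have [after|before] := pselect (after_supp u t).
- rewrite (xt after) big_add1/= big_mkord !mxE summxE; congr (_ + _).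
  rewrite /delay_response big_split/=; congr (_ + _).
    rewrite exchange_big/=; apply: eq_bigr => l _; rewrite mxE.
    by apply: eq_bigr => k _; rewrite (addrC t).
  by apply: eq_bigr => k _; rewrite fun_conv_itv.
- rewrite nxt// mxE ut; last by move=> ts; apply: before; exists t.
  rewrite [X in _ + X]big1 ?addr0 => [|k _]; last by rewrite mxE mulr0.
  rewrite big1// => k _; rewrite /delay_response fun_conv_before// addr0.
  rewrite big1// => l _; rewrite dt ?mxE ?mulr0// => tl.
  apply/before/(after_suppW _ tl); have /andP[Ll0 _] := delays l.
  by rewrite gerDr oppr_le0 ltW.
Qed.

End delay_equation.

Lemma DI_io_convolution (R : realType) (d m N : nat) (q : R) (Lam : nat -> R)
    (A : nat -> 'M[R]_(d, d)) (B : 'M[R]_(d, m))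
    (h : R -> 'M[R]_(d, d)) (G : R) u y :
  1 <= q -> (forall l : 'I_N, 0 < Lam l.+1 <= Lam N) ->
  bounded_density (Lam N) G h ->
  Omega q u -> DI_io N q Lam A B h u y ->
  convolution_io (delay_kernel N Lam A h) B (Lam N) q u y.
Proof.
move=> q1 delays hd Ou [x [xq [x_eq [x_before yx]]]].
have [a a_supp cu] := Omega_causal q1 Ou.
have cx : causal_cV a x.
  move=> k; split; first exact: Lq_loc_locally_integrable q1 (xq k).
  by apply: filterS x_before => t xt ta; rewrite xt ?mxE// => /a_supp/ta.
exists a, x; split=> //; apply: (fdistr_delay_equation hd cu cx).
have [mh _ h0] := hd; apply: state_equation => // [k|k]; first by have [] := xq k.
by have [[]] := cu k.
Qed.

Lemma increasing_delays (R : realType) (N : nat) (Lam : nat -> R) :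
  0 < Lam 1%N -> (forall j, (1 <= j < N)%N -> Lam j < Lam j.+1) ->
  forall l : 'I_N, 0 < Lam l.+1 <= Lam N.
Proof.
move=> Lam1 inc.
have mono i k : (0 < i)%N -> (i + k <= N)%N -> Lam i <= Lam (i + k)%N.
  move=> i0; elim: k => [|k IHk] ikN; first by rewrite addn0.
  rewrite addnS in ikN *; apply: (le_trans (IHk (ltnW ikN))); apply/ltW/inc.
  by rewrite ikN addn_gt0 i0.
move=> l; apply/andP; split.
  by rewrite (lt_le_trans Lam1)// -add1n mono// add1n.
by rewrite -{2}(subnKC (ltn_ord l)) mono// subnKC.
Qed.

Theorem theorem5 (R : realType) (d m N : nat) (Lam : nat -> R)
    (A : nat -> 'M[R]_(d, d)) (B : 'M[R]_(d, m)) (g : R -> 'M[R]_(d, d)) (q : R) :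
  (0 < d)%N -> (0 < m)%N -> (0 < N)%N ->
  0 < Lam 1%N ->
  (forall j, (1 <= j < N)%N -> Lam j < Lam j.+1) ->
  (forall i j, measurable_fun `[0, Lam N] (fun s => g s i j)) ->
  (exists M : R, {ae (@lebesgue_measure R), forall s, s \in `[0, Lam N] ->
       forall i j, `|g s i j| <= M}) ->
  1 <= q ->
  @pseudo_rational0 R d m q (@DI_io R d m N q Lam A B g).
Proof.
move=> _ _ N0 Lam1 Lam_inc mg [M gM] q1.
have delays := increasing_delays Lam1 Lam_inc.
have L0 : 0 <= Lam N.
  by have /andP[L1 LN] := delays (Ordinal N0); exact: ltW (lt_le_trans L1 LN).
have [h hd gh] := bounded_representative mg gM.
apply: (pseudo_rational0_convolution (B := B) L0
  (radon_mx_delay_kernel A L0 delays hd)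
  (delay_kernel_negligible A delays hd)) => u y Ou DI.
apply: (DI_io_convolution q1 delays hd Ou); apply: DI_io_ae_eq DI => // i j.
by have [mh _ _] := hd; exact: measurable_funTS.
Qed.
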